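(* Let $f_0$ be a fixed probability density on $[0,1]$ belonging to $\mathbb L_2([0,1])$. For all integers $n\ge2$, all $s>0$, $R>0$, $\alpha\ge 1/\sqrt n$ and $(\gamma,\beta)\in(0,1)^2$ with $\gamma+\beta<1$, let $L^*=2^{J^*}$, where $J^*$ is the smallest integer $J$ such that $2^J\ge (n\alpha^2)^{2/(4s+3)}\wedge n^{2/(4s+1)}$. Consider the private views $Z_1,\dots,Z_n$ produced by the Laplace channel $Q$ with $L=L^*$ and parameter $\alpha$, and the test $\Delta_{L^*,\gamma,Q}$ of $H_0:f=f_0$ against $H_1:f\ne f_0$ (both defined in the context). Then the uniform separation rate of this test over $\mathcal B_{s,2,\infty}(R)$ satisfies $$\rho_n\left(\Delta_{L^*,\gamma,Q},\mathcal B_{s,2,\infty}(R),\beta,f_0\right)\ \le\ C(s,R,\|f_0\|_2,\gamma,\beta)\left[(n\alpha^2)^{-2s/(4s+3)}\vee n^{-2s/(4s+1)}\right],$$ where $C(s,R,\|f_0\|_2,\gamma,\beta)$ is a constant depending only on its arguments.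
   Context: Notation: $a\wedge b=\min(a,b)$, $a\vee b=\max(a,b)$; $\|\cdot\|_2$ is the norm of $\mathbb L_2([0,1])$ (Lebesgue measure). $X_1,\dots,X_n$ are i.i.d. with values in $[0,1]$ and density $f\in\mathbb L_2([0,1])$; they are not observed. Laplace channel. For an integer $L\ge1$ and $k\in\{0,\dots,L-1\}$ let $\varphi_{L,k}(x)=\sqrt L\,\mathbf 1_{[0,1)}(Lx-k)$. The private views are $Z_i=Z_{i,L}=(Z_{i,L,k})_{0\le k\le L-1}$ with $$Z_{i,L,k}=\varphi_{L,k}(X_i)+\sigma_L W_{i,L,k},\qquad \sigma_L=2\sqrt2\,\frac{\sqrt L}{\alpha},$$ where the $W_{i,L,k}$ are i.i.d. Laplace random variables, centered with variance $1$, independent of $(X_1,\dots,X_n)$. $Q$ denotes this channel and $\mathbb P_{Q^n_f}$ the law of $(Z_1,\dots,Z_n)$ when the $X_i$ have density $f$. Test. With $\alpha^0_{L,k}=\int_0^1\varphi_{L,k}(x)f_0(x)\,dx$, $$\hat T_L=\frac1{n(n-1)}\sum_{i\ne l=1}^n\sum_{k=0}^{L-1}(Z_{i,L,k}-\alpha^0_{L,k})(Z_{l,L,k}-\alpha^0_{L,k}),\qquad \Delta_{L,\gamma,Q}(Z_1,\dots,Z_n)=\mathbf 1_{\hat T_L>t^0_L(1-\gamma)},$$ where $t^0_L(1-\gamma)$ is the $(1-\gamma)$-quantile of $\hat T_L$ under $\mathbb P_{Q^n_{f_0}}$. Uniform separation rate. For a class $\mathcal C\subset\mathbb L_2([0,1])$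 (supremum over the probability densities $f$ in $\mathcal C$), $$\rho_n(\Delta_{\gamma,Q},\mathcal C,\beta,f_0)=\inf\Big\{\rho>0:\ \sup_{f\in\mathcal C,\ \|f-f_0\|_2>\rho}\mathbb P_{Q^n_f}(\Delta_{\gamma,Q}(Z_1,\dots,Z_n)=0)\le\beta\Big\}.$$ Besov class (Haar basis). Let $\psi=\mathbf 1_{[0,1/2)}-\mathbf 1_{[1/2,1)}$, $\Lambda(j)=\{0,1,\dots,2^j-1\}$ and $\beta_{j,k}(g)=\int_0^1 2^{j/2}g(x)\psi(2^jx-k)\,dx$. Put $$\widetilde B_{s,2,\infty}(R)=\Big\{g\in\mathbb L_2([0,1]):\ \forall j\ge0,\ \sum_{k\in\Lambda(j)}\beta_{j,k}^2(g)\le R^2 2^{-2js}\Big\},\qquad \mathcal B_{s,2,\infty}(R)=\{f\in\mathbb L_2([0,1]):\ f-f_0\in\widetilde B_{s,2,\infty}(R)\}.$$ *)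

(* Defs.v *)
From HB Require Import structures.
From mathcomp Require Import all_boot all_order all_algebra.
From mathcomp Require Import all_classical all_reals all_analysis.
From mathcomp Require Import measurable_realfun.

Set Implicit Arguments.
Unset Strict Implicit.
Unset Printing Implicit Defensive.

Import Order.TTheory GRing.Theory Num.Theory.
Import numFieldNormedType.Exports.

Local Open Scope classical_set_scope.
Local Open Scope ring_scope.

(* Functions on [0, 1] are represented by functions R -> R whose values outside
   [0, 1] are never used: they are replaced by 0 before taking norms, and
   integrals run over `[0, 1] only. *)

Section L2_unit_interval.
Context {R : realType}.

Definition L2 (g : R -> R) : Prop :=
  g \_ `[0, 1] \in Lfun (@lebesgue_measure R) 2%:E.

Definition norm2 (g : R -> R) : \bar R :=
  ('N[lebesgue_measure]_2%:E[EFin \o (g \_ `[0, 1])%R])%E.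

End L2_unit_interval.

Record density (R : realType) := Density {
  density_fun :> R -> R ;
  measurable_density : measurable_fun (`[0, 1]%classic : set R) density_fun ;
  density_ge0 : forall x : R, 0 <= x <= 1 -> 0 <= density_fun x ;
  integral_density :
    (\int[lebesgue_measure]_(x in `[0%R, 1%R]) (density_fun x)%:E = 1)%E }.

Definition density_prob {R : realType} (f : density R) :
    set (measurableTypeR R) -> \bar R :=
  fun A => (\int[lebesgue_measure]_(x in A `&` `[0%R, 1%R]) (f x)%:E)%E.

Section density_prob.
Context {R : realType} (f : density R).
Local Notation mu := (@lebesgue_measure R).

Let density_prob0 : density_prob f set0 = 0%E.
Proof. by rewrite /density_prob set0I integral_set0. Qed.

Let density_prob_ge0 A : (0 <= density_prob f A)%E.
Proof.
by apply: integral_ge0 => x [_ x01]; rewrite lee_fin density_ge0.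
Qed.

Let density_prob_sigma_additive : semi_sigma_additive (density_prob f).
Proof.
move=> /= F mF tF mUF; rewrite /density_prob; apply: cvg_toP.
  apply: ereal_nondecreasing_is_cvgn => m n mn.
  apply: lee_sum_nneg_natr => // k _ _; exact: density_prob_ge0.
rewrite setI_bigcupl ge0_integral_bigcup//=.
- by move=> k; exact: measurableI.
- apply/measurable_EFinP; apply: measurable_funS (measurable_density f) => //.
  by move=> x [k _ []].
- by move=> x [k _ [_ x01]]; rewrite lee_fin density_ge0.
- apply/trivIsetP => i j _ _ ij.
  by rewrite setIACA setIid (trivIsetP.1 tF)// set0I.
Qed.

HB.instance Definition _ := isMeasure.Build _ _ _
  (density_prob f) density_prob0 density_prob_ge0 density_prob_sigma_additive.

Let density_prob_setT : density_prob f [set: R] = 1%E.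
Proof. by rewrite /density_prob setTI integral_density. Qed.

HB.instance Definition _ :=
  @Measure_isProbability.Build _ _ R (density_prob f) density_prob_setT.

End density_prob.

(* The density of the Laplace distribution with location 0 and scale b is
   exp (- |w| / b) / (2 b) and its variance is 2 b ^ 2; variance 1 means
   b = 1 / sqrt 2. *)
Definition laplace_pdf {R : realType} (w : R) : R :=
  (Num.sqrt 2)^-1 * expR (- (Num.sqrt 2 * `|w|)).

Definition laplace_prob {R : realType} : set (measurableTypeR R) -> \bar R :=
  fun A => (\int[lebesgue_measure]_(w in A) (laplace_pdf w)%:E)%E.

Section laplace_prob.
Context {R : realType}.
Local Notation mu := (@lebesgue_measure R).
Local Notation laplace_pdf := (@laplace_pdf R).

Lemma laplace_pdf_ge0 w : 0 <= laplace_pdf w.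
Proof. by rewrite mulr_ge0// ?invr_ge0 ?sqrtr_ge0// expR_ge0. Qed.

Lemma measurable_laplace_pdf : measurable_fun [set: R] laplace_pdf.
Proof.
apply: measurable_funM => //; apply: measurableT_comp => //.
apply: measurableT_comp => //; apply: measurable_funM => //.
Qed.

Lemma integral_laplace_pdf : (\int[mu]_w (laplace_pdf w)%:E = 1)%E.
Proof.
have mE (D : set R) : measurable_fun D (EFin \o laplace_pdf).
  by apply/measurable_funTS/measurable_EFinP; exact: measurable_laplace_pdf.
have s0 : 0 < Num.sqrt 2 :> R by rewrite sqrtr_gt0.
have half : (\int[mu]_(w in `[0%R, +oo[) (laplace_pdf w)%:E = (2^-1)%:E)%E.
  transitivity
      (\int[mu]_(w in `[0%R, +oo[) ((2^-1)%:E * (exponential_pdf (Num.sqrt 2) w)%:E))%E.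
    apply: eq_integral => w; rewrite inE/= in_itv/= andbT => w0.
    rewrite -EFinM exponential_pdfE// /laplace_pdf ger0_norm// mulrA mulNr.
    congr (_ * _)%:E; apply: (mulfI (lt0r_neq0 s0)); rewrite mulfV ?lt0r_neq0//.
    by rewrite mulrCA -expr2 sqr_sqrtr// mulVf.
  rewrite ge0_integralZl//=.
  - rewrite (_ : (\int[mu]_(w in _) _ = 1)%E) ?mule1//.
    rewrite -[RHS](@integral_exponential_pdf R _ s0) [LHS]integral_mkcond.
    apply: eq_integral => w _; rewrite patchE; case: ifPn => //.
    rewrite notin_setE/= in_itv/= andbT => /negP; rewrite -ltNge => w0.
    by rewrite lt0_exponential_pdf.
  - apply/measurable_funTS/measurable_EFinP; exact: measurable_exponential_pdf.
  - by move=> w _; rewrite lee_fin exponential_pdf_ge0// ltW.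
have halfN : (\int[mu]_(w in `]-oo, 0%R]) (laplace_pdf w)%:E = (2^-1)%:E)%E.
  rewrite -half ge0_integration_by_substitution0//; last first.
    by move=> w; rewrite lee_fin laplace_pdf_ge0.
  by apply: eq_integral => w _; rewrite /laplace_pdf normrN.
rewrite -(setUv `[0%R, +oo[%classic) ge0_integral_setU//=.
- rewrite half setCitvr integral_itv_bndo_bndc// ?halfN.
    by rewrite -EFinD -[in RHS](@mulVf _ 2)// mulr_natr mulr2n.
- exact: measurableC.
- exact: mE.
- by move=> w _; rewrite lee_fin laplace_pdf_ge0.
- by rewrite disj_set2E setICr.
Qed.

Let laplace0 : laplace_prob set0 = 0%E :> \bar R.
Proof. by rewrite /laplace_prob integral_set0. Qed.

Let laplace_ge0 A : (0 <= laplace_prob A :> \bar R)%E.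
Proof. by apply: integral_ge0 => x _; rewrite lee_fin laplace_pdf_ge0. Qed.

Let laplace_sigma_additive : semi_sigma_additive (@laplace_prob R).
Proof.
move=> /= F mF tF mUF; rewrite /laplace_prob; apply: cvg_toP.
  apply: ereal_nondecreasing_is_cvgn => m n mn.
  apply: lee_sum_nneg_natr => // k _ _; exact: laplace_ge0.
rewrite ge0_integral_bigcup//=.
- by apply/measurable_funTS/measurable_EFinP; exact: measurable_laplace_pdf.
- by move=> x _; rewrite lee_fin laplace_pdf_ge0.
Qed.

HB.instance Definition _ := isMeasure.Build _ _ _
  (@laplace_prob R) laplace0 laplace_ge0 laplace_sigma_additive.

Let laplace_setT : laplace_prob [set: R] = 1%E.
Proof. exact: integral_laplace_pdf. Qed.

HB.instance Definition _ :=
  @Measure_isProbability.Build _ _ R (@laplace_prob R) laplace_setT.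

End laplace_prob.

Section iid.
Context {d} {T : measurableType d} {R : realType}.

Definition pair_cons n (x : T * n.-tuple T) : n.+1.-tuple T :=
  [tuple of x.1 :: x.2].

Lemma measurable_pair_cons n : measurable_fun [set: T * n.-tuple T] (@pair_cons n).
Proof. exact: measurable_cons. Qed.

HB.instance Definition _ n :=
  isMeasurableFun.Build _ _ _ _ (@pair_cons n) (@measurable_pair_cons n).

(* The n-fold product probability P \x ... \x P, that is, the law of n
   independent random variables with law P. *)
Fixpoint iid_prob (P : probability T R) n : probability (n.-tuple T) R :=
  match n with
  | 0 => \d_([tuple] : 0.-tuple T)
  | m.+1 => distribution (P \x iid_prob P m)%E (@pair_cons m)
  end.

End iid.

Section laplace_channel.
Context {R : realType}.
Implicit Types (alpha : R) (L n k : nat).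

Definition phi L k (x : R) : R :=
  Num.sqrt L%:R * \1_(`[0, 1[%classic : set R) (L%:R * x - k%:R).

Definition sigma alpha L : R := 2 * Num.sqrt 2 * (Num.sqrt L%:R / alpha).

Lemma measurable_phi L k : measurable_fun [set: R] (phi L k).
Proof.
apply: measurable_funM => //.
apply: (@measurableT_comp _ _ _ _ _ _ (\1_(`[0, 1[%classic : set R) : R -> R)).
  exact: measurable_indic.
by apply: measurable_funB => //; exact: measurable_funM.
Qed.

(* A point of the sample space consists of the X_i, i < n, and of the W_(i,k),
   i < n and k < L. *)
Local Notation sample L n :=
  (n.-tuple (measurableTypeR R) * n.-tuple (L.-tuple (measurableTypeR R)))%type.

Definition sample_prob (f : density R) L n : probability (sample L n) R :=
  (iid_prob (density_prob f) n \x iid_prob (iid_prob laplace_prob L) n)%E.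

Definition views alpha L n (w : sample L n) : n.-tuple (L.-tuple (measurableTypeR R)) :=
  [tuple [tuple phi L k (tnth w.1 i) + sigma alpha L * tnth (tnth w.2 i) k
         | k < L] | i < n].

Lemma measurable_views alpha L n :
  measurable_fun [set: sample L n] (@views alpha L n).
Proof.
apply/measurable_fun_tnthP => i; apply/measurable_fun_tnthP => k.
rewrite (_ : _ \o _ = fun w : sample L n =>
    phi L k (tnth w.1 i) + sigma alpha L * tnth (tnth w.2 i) k); last first.
  by apply/funext => w /=; rewrite !tnth_mktuple.
apply: measurable_funD.
- apply: (@measurableT_comp _ _ _ _ _ _ (phi L k)); first exact: measurable_phi.
  by apply: (measurableT_comp (measurable_tnth _)); exact: measurable_fst.
- apply: measurable_funM => //.
  apply: (measurableT_comp (measurable_tnth _)).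
  by apply: (measurableT_comp (measurable_tnth _)); exact: measurable_snd.
Qed.

HB.instance Definition _ alpha L n :=
  isMeasurableFun.Build _ _ _ _ (@views alpha L n) (@measurable_views alpha L n).

Definition views_prob alpha (f : density R) L n :
    probability (n.-tuple (L.-tuple (measurableTypeR R))) R :=
  distribution (sample_prob f L n) (@views alpha L n).

End laplace_channel.

Section test.
Context {R : realType}.
Implicit Types (alpha gamma beta : R) (L n k : nat) (f : density R).
Local Notation private_views L n := (n.-tuple (L.-tuple (measurableTypeR R))).

Definition quantile d (T : measurableType d) (P : probability T R) (S : T -> R)
    (u : R) : R :=
  inf [set t : R | (u%:E <= P [set x | (S x <= t)%R])%E].

Definition alpha0 (f0 : density R) L k : R :=
  \int[lebesgue_measure]_(x in `[0%R, 1%R]) (phi L k x * f0 x).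

Definition Tstat (f0 : density R) L n (z : private_views L n) : R :=
  (n%:R * (n%:R - 1))^-1 *
  \sum_(i < n) \sum_(l < n | l != i) \sum_(k < L)
    (tnth (tnth z i) k - alpha0 f0 L k) *
    (tnth (tnth z l) k - alpha0 f0 L k).

Definition test alpha gamma (f0 : density R) L n (z : private_views L n) : nat :=
  (quantile (views_prob alpha f0 L n) (@Tstat f0 L n) (1 - gamma)
   < @Tstat f0 L n z)%R.

(* The infimum is taken in \bar R, so that it is +oo when no rho is suitable. *)
Definition sep_rate alpha L n (D : private_views L n -> nat)
    (C : set (R -> R)) beta (f0 : R -> R) : \bar R :=
  ereal_inf [set rho%:E | rho in [set rho : R | 0 < rho /\
    (ereal_sup [set views_prob alpha f L n [set z | D z = 0%N]
      | f in [set f : density R | C f /\ (rho%:E < norm2 (f \- f0)%R)%E]]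
     <= beta%:E)%E]].

End test.

Section besov.
Context {R : realType}.
Implicit Types (g f : R -> R) (j k : nat) (s r : R).

Definition psi (x : R) : R :=
  \1_(`[0, 2^-1[%classic : set R) x - \1_(`[2^-1, 1[%classic : set R) x.

Definition haar_coef j k g : R :=
  \int[lebesgue_measure]_(x in `[0%R, 1%R])
    (2 `^ (j%:R / 2) * g x * psi (2 ^+ j * x - k%:R)).

Definition besov0 s r : set (R -> R) :=
  [set g | L2 g /\ forall j,
    \sum_(k < 2 ^ j) haar_coef j k g ^+ 2 <= r ^+ 2 * 2 `^ (- (2 * j%:R * s))].

Definition besov (f0 : R -> R) s r : set (R -> R) :=
  [set f | L2 f /\ besov0 s r (f \- f0)].

End besov.

Definition smallest_exponent {R : realType} (x : R) (J : nat) : Prop :=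
  x <= 2 ^+ J /\ forall J' : int, x <= 2 ^ J' -> (J%:Z <= J')%R.

(* Main.v *)
Require Import Defs.
From HB Require Import structures.
From mathcomp Require Import all_boot all_order all_algebra.
From mathcomp Require Import all_classical all_reals all_analysis.
From mathcomp Require Import measurable_realfun.
From mathcomp Require Import ring lra.

Set Implicit Arguments.
Unset Strict Implicit.
Unset Printing Implicit Defensive.

Import Order.TTheory GRing.Theory Num.Theory.
Import numFieldNormedType.Exports.

Local Open Scope classical_set_scope.
Local Open Scope ring_scope.

(** The rate is a balance between a bias and a standard deviation.

Write [L = 2 ^ J], let [m] be the vector of the differences of the means of the
views under [f] and under [f0], and [a = |m| ^ 2] ([energy]). The statistic is
an unbiased estimator of [a]. By the Hoeffding decomposition ([Tstat_decomp])
its error is a linear term plus a degenerate U-statistic of independent centered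
vectors whose covariance matrix is explicit ([noise_cov]); the second moment of
the U-statistic is computed by a martingale recursion ([ustat_sqr]). This bounds
the mean squared error ([Tstat_mse]) by
[8 * a * q * M + 64 * q ^ 2 * M ^ 2], where
[q = sqrt L / n + L * sqrt L / (n * alpha ^ 2)] is [noise_rate] and [M] depends
on the norm of the means under [f], which is at most twice the sum of
[sqrt a] and the norm of [f0].

Under the null hypothesis [a = 0], so Chebyshev's inequality puts the quantile
below a multiple of [q]. When [a] exceeds a large multiple of the squared rate,
which dominates [q], the quantile is below [a / 2] and Chebyshev's inequality
bounds the probability that the statistic falls below it ([test_type2_le]).

It remains to compare [a] with the distance of [f] to [f0]. The number [a] is the
squared norm of the projection of [f - f0] on the functions that are constant on
the dyadic intervals of level [J]. Passing from one level to the next adds the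
squares of the Haar coefficients ([proj_energyS]), which the Besov condition
sums to at most a multiple of [2 ^ (- 2 J s)], and the projections recover the
norm in the limit by Lebesgue differentiation and Fatou's lemma
([integral_sqr_le_proj_energy]). Finally the choice of [J] makes both [q] and
[2 ^ (- 2 J s)] at most a multiple of the square of the announced rate
([rate_bounds]). *)

(** * Square-integrable functions and product measures *)

Section square_integrable.
Context d (T : measurableType d) (R : realType).
Implicit Types X Y : T -> R.

(** Square integrability as a statement about [X ^ 2], the form in which Fubini
and the transport of integrals apply to it. *)
Lemma Lfun2P (mu : {measure set T -> \bar R}) X :
  X \in Lfun mu 2%:E <->
  measurable_fun setT X /\ mu.-integrable setT (fun x => (X x ^+ 2)%:E).
Proof.
split=> [L2X|[mX iX]].
  by split; [move: L2X => /andP[/[!inE]]|exact: Lfun2_integrable_sqr].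
apply/andP; rewrite !inE/=; split=> //; rewrite /finite_norm unlock /Lnorm.
apply: poweR_lty.
under eq_integral do rewrite /= powR_mulrn// real_normK ?num_real//.
move/integrableP : iX => [_]; congr (_ < _)%E.
by apply: eq_integral => x _; rewrite gee0_abs// lee_fin sqr_ge0.
Qed.

Context (P : probability T R).

Lemma Rintegral_cst1 (a : R) : \int[P]_x a = a.
Proof. by rewrite Rintegral_cst//= probability_setT mulr1. Qed.

Lemma Lfun2_integrable X : X \in Lfun P 2%:E -> P.-integrable setT (EFin \o X).
Proof.
move=> L2X; apply/Lfun1_integrable/Lfun_subset12 => //.
exact: fin_num_measure.
Qed.

Lemma Lfun2M_integrable X Y : X \in Lfun P 2%:E -> Y \in Lfun P 2%:E ->
  P.-integrable setT (EFin \o (fun x => X x * Y x)).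
Proof. by move=> L2X L2Y; apply/Lfun1_integrable/Lfun2_mul_Lfun1. Qed.

Lemma Lfun2D X Y : X \in Lfun P 2%:E -> Y \in Lfun P 2%:E ->
  (fun x => X x + Y x) \in Lfun P 2%:E.
Proof. by move=> L2X L2Y; apply: (Lfun_addr_closed _ _).2; rewrite ?lee1n. Qed.

Lemma Lfun2Z a X : X \in Lfun P 2%:E -> (fun x => a * X x) \in Lfun P 2%:E.
Proof.
move=> L2X; rewrite (_ : (fun _ => _) = a \o* X); last first.
  by apply/funext => x /=; rewrite mulrC.
by apply: Lfun_scale => //; rewrite ler1n.
Qed.

Lemma Lfun2_sum I (s : seq I) (p : pred I) (X : I -> T -> R) :
  (forall i, p i -> X i \in Lfun P 2%:E) ->
  (fun x => \sum_(i <- s | p i) X i x) \in Lfun P 2%:E.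
Proof.
move=> L2X; elim: s => [|i s ih].
  under eq_fun do rewrite big_nil.
  exact: Lfun_cst.
under eq_fun do rewrite big_cons.
by have [/L2X L2Xi|_] := boolP (p i); [exact: Lfun2D|exact: ih].
Qed.

Lemma integrable_addR X Y : P.-integrable setT (EFin \o X) ->
  P.-integrable setT (EFin \o Y) ->
  P.-integrable setT (EFin \o (fun x => X x + Y x)).
Proof.
move=> iX iY; rewrite (_ : _ \o _ = (EFin \o X) \+ (EFin \o Y))%E//.
exact: integrableD.
Qed.

Lemma integrable_scaleR a X : P.-integrable setT (EFin \o X) ->
  P.-integrable setT (EFin \o (fun x => a * X x)).
Proof.
move=> iX; rewrite (_ : _ \o _ = (fun x => a%:E * (EFin \o X) x))%E//.
exact: integrableZl.
Qed.

End square_integrable.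

Section integral_of_sum.
Context d (T : measurableType d) (R : realType).
Context (mu : {measure set T -> \bar R}) (D : set T).
Context (I : Type) (X : I -> T -> R).

Lemma integrable_sumR (s : seq I) (p : pred I) : measurable D ->
  (forall i, p i -> mu.-integrable D (EFin \o X i)) ->
  mu.-integrable D (EFin \o (fun x => \sum_(i <- s | p i) X i x)).
Proof.
move=> mD iX; elim: s => [|i s ih].
  rewrite (_ : _ \o _ = cst 0%E) ?integrable0//.
  by apply/funext => x /=; rewrite big_nil.
have [pi|pi] := boolP (p i); last first.
  by under eq_fun do rewrite /= big_cons (negbTE pi); exact: ih.
pose Y x := \sum_(i <- s | p i) X i x.
rewrite (_ : _ \o _ = (EFin \o X i) \+ (EFin \o Y))%E.
  by apply: integrableD => //; exact: iX.
by apply/funext => x /=; rewrite big_cons pi EFinD.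
Qed.

Lemma Rintegral_sum (s : seq I) (p : pred I) : measurable D ->
  (forall i, p i -> mu.-integrable D (EFin \o X i)) ->
  \int[mu]_(x in D) (\sum_(i <- s | p i) X i x) =
  \sum_(i <- s | p i) \int[mu]_(x in D) X i x.
Proof.
move=> mD iX; elim: s => [|i s ih].
  under eq_Rintegral do rewrite big_nil.
  by rewrite Rintegral_cst// mul0r big_nil.
rewrite big_cons; under eq_Rintegral do rewrite big_cons.
have [pi|pi] := boolP (p i); last exact: ih.
by rewrite RintegralD ?ih//; [exact: iX|exact: integrable_sumR].
Qed.

End integral_of_sum.

Section product_integral.
Context d d' (T : measurableType d) (T' : measurableType d') (R : realType).
Context (P : probability T R) (Q : probability T' R).

Lemma integrable_prod_mul (F : T -> R) (G : T' -> R) :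
  P.-integrable setT (EFin \o F) -> Q.-integrable setT (EFin \o G) ->
  (P \x Q)%E.-integrable setT (EFin \o (fun z => F z.1 * G z.2)).
Proof.
move=> iF iG.
have mF : measurable_fun setT F by apply/measurable_EFinP; case/integrableP: iF.
have mG : measurable_fun setT G by apply/measurable_EFinP; case/integrableP: iG.
apply/integrable12ltyP.
  apply/measurable_EFinP/measurable_funM.
    exact: measurableT_comp mF measurable_fst.
  exact: measurableT_comp mG measurable_snd.
under eq_integral => x _.
  under eq_integral => y _ do rewrite /= normrM EFinM.
  rewrite ge0_integralZl//; last first.
    by apply/measurable_EFinP/measurableT_comp.
  over.
rewrite ge0_integralZr//; last 2 first.
- by apply/measurable_EFinP/measurableT_comp.
- exact: integral_ge0.
have /integrableP[_ iF'] := iF; have /integrableP[_ iG'] := iG.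
apply: lte_mul_pinfty => //; first exact: integral_ge0.
by rewrite ge0_fin_numE//; exact: integral_ge0.
Qed.

Lemma Rintegral_prod_mul (F : T -> R) (G : T' -> R) :
  P.-integrable setT (EFin \o F) -> Q.-integrable setT (EFin \o G) ->
  \int[(P \x Q)%E]_z (F z.1 * G z.2) = \int[P]_x F x * \int[Q]_y G y.
Proof.
move=> iF iG; rewrite /Rintegral -integral12_prod_meas1; last exact: integrable_prod_mul.
rewrite /fubini_F/=; under eq_integral => x _.
  under eq_integral => y _ do rewrite EFinM.
  rewrite integralZl//.
  rewrite -[X in (_ * X)%E]fineK; last by apply: integrable_fin_num.
  over.
rewrite integralZr// fineM//; first exact: integrable_fin_num.
Qed.

Lemma Lfun2_prod_mul (F : T -> R) (G : T' -> R) :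
  F \in Lfun P 2%:E -> G \in Lfun Q 2%:E ->
  (fun z => F z.1 * G z.2) \in Lfun (P \x Q)%E 2%:E.
Proof.
move=> /Lfun2P[mF iF] /Lfun2P[mG iG]; apply/Lfun2P; split.
  apply: measurable_funM.
    exact: measurableT_comp mF measurable_fst.
  exact: measurableT_comp mG measurable_snd.
under eq_fun do rewrite exprMn.
exact: (@integrable_prod_mul (fun x => F x ^+ 2) (fun y => G y ^+ 2)).
Qed.

End product_integral.

Section marginals.
Context d d' (T : measurableType d) (T' : measurableType d') (R : realType).
Context (P : probability T R) (Q : probability T' R).

Lemma integrable_fst (F : T -> R) : P.-integrable setT (EFin \o F) ->
  (P \x Q)%E.-integrable setT (EFin \o (fun z => F z.1)).
Proof.
move=> iF; rewrite (_ : EFin \o _ =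
    EFin \o (fun z : T * T' => F z.1 * (cst 1 : T' -> R) z.2)); last first.
  by apply/funext => z /=; rewrite mulr1.
by apply: integrable_prod_mul => //; exact: finite_measure_integrable_cst.
Qed.

Lemma integrable_snd (G : T' -> R) : Q.-integrable setT (EFin \o G) ->
  (P \x Q)%E.-integrable setT (EFin \o (fun z => G z.2)).
Proof.
move=> iG; rewrite (_ : EFin \o _ =
    EFin \o (fun z : T * T' => (cst 1 : T -> R) z.1 * G z.2)); last first.
  by apply/funext => z /=; rewrite mul1r.
by apply: integrable_prod_mul => //; exact: finite_measure_integrable_cst.
Qed.

Lemma Rintegral_fst (F : T -> R) : P.-integrable setT (EFin \o F) ->
  \int[(P \x Q)%E]_z (F z.1) = \int[P]_x F x.
Proof.
move=> iF; rewrite -[RHS]mulr1 -[in RHS](Rintegral_cst1 Q 1).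
rewrite -Rintegral_prod_mul//; last exact: finite_measure_integrable_cst.
by apply: eq_Rintegral => z _; rewrite mulr1.
Qed.

Lemma Rintegral_snd (G : T' -> R) : Q.-integrable setT (EFin \o G) ->
  \int[(P \x Q)%E]_z (G z.2) = \int[Q]_y G y.
Proof.
move=> iG; rewrite -[RHS]mul1r -[in RHS](Rintegral_cst1 P 1).
rewrite -Rintegral_prod_mul//; last exact: finite_measure_integrable_cst.
by apply: eq_Rintegral => z _; rewrite mul1r.
Qed.

Lemma Lfun2_fst (F : T -> R) : F \in Lfun P 2%:E ->
  (fun z => F z.1) \in Lfun (P \x Q)%E 2%:E.
Proof.
move=> L2F; rewrite (_ : (fun _ => _) =
    fun z : T * T' => F z.1 * (cst 1 : T' -> R) z.2); last first.
  by apply/funext => z /=; rewrite mulr1.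
by apply: Lfun2_prod_mul => //; exact: Lfun_cst.
Qed.

Lemma Lfun2_snd (G : T' -> R) : G \in Lfun Q 2%:E ->
  (fun z => G z.2) \in Lfun (P \x Q)%E 2%:E.
Proof.
move=> L2G; rewrite (_ : (fun _ => _) =
    fun z : T * T' => (cst 1 : T -> R) z.1 * G z.2); last first.
  by apply/funext => z /=; rewrite mul1r.
by apply: Lfun2_prod_mul => //; exact: Lfun_cst.
Qed.

End marginals.

Section distribution_integral.
Context d d' (T : measurableType d) (T' : measurableType d') (R : realType).
Context (P : probability T R) (X : {RV P >-> T'}).

Lemma integrable_distribution (F : T' -> R) : measurable_fun setT F ->
  P.-integrable setT (EFin \o (fun x => F (X x))) ->
  (distribution P X).-integrable setT (EFin \o F).
Proof.
move=> mF iF; apply: integrable_pushforward => //.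
exact/measurable_EFinP.
Qed.

Lemma Rintegral_distribution (F : T' -> R) : measurable_fun setT F ->
  P.-integrable setT (EFin \o (fun x => F (X x))) ->
  \int[distribution P X]_y F y = \int[P]_x F (X x).
Proof.
move=> mF iF; rewrite /Rintegral integral_distribution//.
exact/measurable_EFinP.
Qed.

Lemma Lfun2_distribution (F : T' -> R) : measurable_fun setT F ->
  (fun x => F (X x)) \in Lfun P 2%:E -> F \in Lfun (distribution P X) 2%:E.
Proof.
move=> mF /Lfun2P[_ iF]; apply/Lfun2P; split=> //.
apply: (@integrable_distribution (fun y => F y ^+ 2)) => //.
exact: measurable_funX.
Qed.

End distribution_integral.

(** * U-statistics of order two *)

Section ustatistic.
Context d (T : measurableType d) (R : realType) (L : nat).
Variable xi : 'I_L -> T -> R.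
Hypothesis mxi : forall k, measurable_fun setT (xi k).

(** The coordinate sums [A_k = xi_k(t_1) + ... + xi_k(t_n)], through which the
sample enters the linear part of the statistic. *)
Definition lstat n k (t : n.-tuple T) : R := \sum_(i < n) xi k (tnth t i).

(** The unnormalised U-statistic of order two whose kernel is the scalar product
of the vectors [xi(x)] and [xi(y)]. *)
Definition ustat n (t : n.-tuple T) : R :=
  \sum_(i < n) \sum_(l < n | l != i) \sum_(k < L)
    xi k (tnth t i) * xi k (tnth t l).

Lemma lstat_cons n k x (t : n.-tuple T) :
  lstat k (pair_cons (x, t)) = xi k x + lstat k t.
Proof.
rewrite /lstat big_ord_recl; congr (_ + _).
by apply: eq_bigr => i _; rewrite /pair_cons tnthS.
Qed.

(** A new observation meets every earlier one in two ordered pairs. This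
recursion in the sample size replaces the case analysis on coinciding indices in
the expansion of [ustat ^ 2]. *)
Lemma ustat_cons n x (t : n.-tuple T) :
  ustat (pair_cons (x, t)) = ustat t + 2 * \sum_(k < L) xi k x * lstat k t.
Proof.
have sumE (y : T) : \sum_(l < n) \sum_(k < L) xi k y * xi k (tnth t l) =
    \sum_(k < L) xi k y * lstat k t.
  by rewrite exchange_big/=; apply: eq_bigr => k _; rewrite mulr_sumr.
rewrite /ustat big_ord_recl big_mkcond big_ord_recl/= add0r.
under eq_bigr do rewrite /pair_cons tnth0 tnthS/=.
rewrite sumE.
under [X in _ + X]eq_bigr => i _.
  rewrite big_mkcond big_ord_recl/= -big_mkcond/=.
  under eq_bigr do rewrite /pair_cons tnth0 tnthS/=.
  under [X in _ + X]eq_bigr do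
    under eq_bigr do rewrite /pair_cons !tnthS/=.
  over.
rewrite big_split/= -/(ustat t) mulr_natl mulr2n addrA addrC; congr (_ + _).
congr (_ + _); rewrite -sumE; apply: eq_bigr => i _.
by apply: eq_bigr => k _; rewrite mulrC.
Qed.

Lemma measurable_lstat n k : measurable_fun setT (@lstat n k).
Proof.
apply: measurable_sum => i; apply: measurableT_comp (mxi k) _.
exact: measurable_tnth.
Qed.

Lemma measurable_ustat n : measurable_fun setT (@ustat n).
Proof.
apply: measurable_sum => i.
under eq_fun do rewrite big_mkcond.
apply: measurable_sum => l; case: (l != i); last exact: measurable_cst.
apply: measurable_sum => k; apply: measurable_funM;
  apply: measurableT_comp (mxi k) _; exact: measurable_tnth.
Qed.

Variable mu : probability T R.
Hypothesis L2xi : forall k, xi k \in Lfun mu 2%:E.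
Hypothesis xi0 : forall k, \int[mu]_x xi k x = 0.

Definition second_moment k k' : R := \int[mu]_x (xi k x * xi k' x).

Lemma Lfun2_lstat n k : @lstat n k \in Lfun (iid_prob mu n) 2%:E.
Proof.
elim: n => [|n ih].
  rewrite (_ : @lstat 0 k = cst 0) ?Lfun_cst//.
  by apply/funext => t; rewrite /lstat big_ord0.
apply: Lfun2_distribution; first exact: measurable_lstat.
rewrite (_ : (fun _ => _) = fun z : T * n.-tuple T => xi k z.1 + lstat k z.2).
  by apply: Lfun2D; [exact: Lfun2_fst|exact: Lfun2_snd].
by apply/funext => -[x t]; rewrite lstat_cons.
Qed.

Lemma Rintegral_lstat_cov n k k' :
  \int[iid_prob mu n]_t (lstat k t * lstat k' t) = n%:R * second_moment k k'.
Proof.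
elim: n => [|n ih].
  by under eq_Rintegral do rewrite /lstat !big_ord0 mul0r;
    rewrite Rintegral_cst1 mul0r.
have E : (fun z : T * n.-tuple T => lstat k (pair_cons z) * lstat k' (pair_cons z)) =
    fun z => (xi k z.1 * xi k' z.1 + lstat k z.2 * lstat k' z.2) +
             (xi k z.1 * lstat k' z.2 + xi k' z.1 * lstat k z.2).
  by apply/funext => -[x t]; rewrite !lstat_cons/=; ring.
have L2l j : @lstat n j \in Lfun (iid_prob mu n) 2%:E by exact: Lfun2_lstat.
have ixx : mu.-integrable setT (EFin \o (fun x => xi k x * xi k' x)).
  exact: Lfun2M_integrable.
have ill : (iid_prob mu n).-integrable setT
    (EFin \o (fun t => lstat k t * lstat k' t)).
  exact: Lfun2M_integrable.
have i1 := integrable_fst (iid_prob mu n) ixx.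
have i2 := integrable_snd mu ill.
have i3 j j' : (mu \x iid_prob mu n)%E.-integrable setT
    (EFin \o (fun z : T * n.-tuple T => xi j z.1 * lstat j' z.2)).
  by apply: integrable_prod_mul => //; exact: Lfun2_integrable.
have i12 := integrable_addR i1 i2.
have i33 := integrable_addR (i3 k k') (i3 k' k).
rewrite (@Rintegral_distribution _ _ _ _ _ _ _
    (fun t => lstat k t * lstat k' t)); last 2 first.
- by apply: measurable_funM; exact: measurable_lstat.
- by rewrite E; exact: integrable_addR.
rewrite E RintegralD// RintegralD// RintegralD//.
rewrite (Rintegral_fst _ ixx) (Rintegral_snd _ ill) ih.
rewrite !Rintegral_prod_mul ?xi0//; try exact: Lfun2_integrable.
by rewrite !mul0r !addr0 -/(second_moment k k') -natr1 mulrDl mul1r addrC.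
Qed.

(** The U-statistic is a martingale: its increment
[2 * \sum_k xi_k(x) * A_k] is orthogonal to the past because [x] is independent
of it and [xi] is centered. The increment from [n] to [n + 1] has second moment
[4 * n] times the sum of the squared covariances, because [A_k] and [A_k'] have
covariance [n * second_moment k k'], and the sum of [4 * m] over [m < n] is
[2 * n * (n - 1)]. *)
Lemma ustat_sqr n :
  @ustat n \in Lfun (iid_prob mu n) 2%:E /\
  \int[iid_prob mu n]_t (ustat t ^+ 2) =
    2 * (n%:R * (n%:R - 1)) * \sum_(k < L) \sum_(k' < L) second_moment k k' ^+ 2.
Proof.
elim: n => [|n [L2u ih]].
  split.
    rewrite (_ : @ustat 0 = cst 0) ?Lfun_cst//.
    by apply/funext => t; rewrite /ustat big_ord0.
  under eq_Rintegral do rewrite /ustat !big_ord0 expr0n.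
  by rewrite Rintegral_cst1 mul0r mulr0 mul0r.
have L2l j : @lstat n j \in Lfun (iid_prob mu n) 2%:E by exact: Lfun2_lstat.
have E : (fun z : T * n.-tuple T => ustat (pair_cons z)) =
    fun z => ustat z.2 + 2 * \sum_(k < L) xi k z.1 * lstat k z.2.
  by apply/funext => -[x t]; rewrite ustat_cons.
have L2uc : (fun z : T * n.-tuple T => ustat (pair_cons z))
    \in Lfun (mu \x iid_prob mu n)%E 2%:E.
  rewrite E; apply: Lfun2D; first exact: Lfun2_snd.
  by apply: Lfun2Z; apply: Lfun2_sum => k _; exact: Lfun2_prod_mul.
split; first by apply: Lfun2_distribution => //; exact: measurable_ustat.
rewrite (@Rintegral_distribution _ _ _ _ _ _ _ (fun t => ustat t ^+ 2));
  last 2 first.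
- by apply: measurable_funX; exact: measurable_ustat.
- exact: Lfun2_integrable_sqr L2uc.
have iuu : (iid_prob mu n).-integrable setT (EFin \o (fun t => ustat t ^+ 2)).
  exact: Lfun2_integrable_sqr.
have ixx k k' : mu.-integrable setT (EFin \o (fun x => xi k x * xi k' x)).
  exact: Lfun2M_integrable.
have ill k k' : (iid_prob mu n).-integrable setT
    (EFin \o (fun t => lstat k t * lstat k' t)).
  exact: Lfun2M_integrable.
have iul k : (iid_prob mu n).-integrable setT
    (EFin \o (fun t => ustat t * lstat k t)).
  exact: Lfun2M_integrable.
have i1 := integrable_snd mu iuu.
have i2 k : (mu \x iid_prob mu n)%E.-integrable setT
    (EFin \o (fun z : T * n.-tuple T => xi k z.1 * (ustat z.2 * lstat k z.2))).
  apply: (@integrable_prod_mul _ _ _ _ _ _ _ (xi k)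
    (fun t => ustat t * lstat k t)) => //; exact: Lfun2_integrable.
have i3 k k' : (mu \x iid_prob mu n)%E.-integrable setT
    (EFin \o (fun z : T * n.-tuple T =>
      xi k z.1 * xi k' z.1 * (lstat k z.2 * lstat k' z.2))).
  exact: (@integrable_prod_mul _ _ _ _ _ _ _ (fun x => xi k x * xi k' x)
    (fun t => lstat k t * lstat k' t)).
have i2s : (mu \x iid_prob mu n)%E.-integrable setT (EFin \o
    (fun z => \sum_(k < L) xi k z.1 * (ustat z.2 * lstat k z.2))).
  exact: integrable_sumR.
have i3r k : (mu \x iid_prob mu n)%E.-integrable setT (EFin \o
    (fun z => \sum_(k' < L) xi k z.1 * xi k' z.1 * (lstat k z.2 * lstat k' z.2))).
  exact: integrable_sumR.
have i3s : (mu \x iid_prob mu n)%E.-integrable setT (EFin \o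
    (fun z => \sum_(k < L) \sum_(k' < L)
      xi k z.1 * xi k' z.1 * (lstat k z.2 * lstat k' z.2))).
  exact: integrable_sumR.
transitivity (\int[(mu \x iid_prob mu n)%E]_z (ustat z.2 ^+ 2 +
   (4 * \sum_(k < L) xi k z.1 * (ustat z.2 * lstat k z.2) +
    4 * \sum_(k < L) \sum_(k' < L)
      xi k z.1 * xi k' z.1 * (lstat k z.2 * lstat k' z.2)))).
  apply: eq_Rintegral => -[x t] _; rewrite ustat_cons/= sqrrD exprMn -addrA.
  congr (_ + (_ + _)).
    under [in RHS]eq_bigr do rewrite mulrCA.
    by rewrite -mulr_sumr; ring.
  under [in RHS]eq_bigr => k _.
    under eq_bigr do rewrite mulrACA.
    rewrite -mulr_sumr; over.
  by rewrite -mulr_suml; ring.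
have j2 := integrable_scaleR 4 i2s.
have j3 := integrable_scaleR 4 i3s.
have j23 := integrable_addR j2 j3.
rewrite RintegralD// RintegralD// RintegralZl// RintegralZl//.
rewrite (Rintegral_snd _ iuu) ih Rintegral_sum//.
rewrite [X in 4 * X + _]big1 => [|k _]; last first.
  apply: etrans (Rintegral_prod_mul (F := xi k)
    (G := fun t => ustat t * lstat k t) _ _) _ => //.
    exact: Lfun2_integrable.
  by rewrite xi0 mul0r.
rewrite Rintegral_sum//.
rewrite [X in _ + 4 * X](eq_bigr (fun k => n%:R * \sum_(k' < L) second_moment k k' ^+ 2)).
  rewrite -mulr_sumr -[n.+1%:R]natr1; ring.
move=> k _; rewrite Rintegral_sum// mulr_sumr; apply: eq_bigr => k' _.
apply: etrans (Rintegral_prod_mul (F := fun x => xi k x * xi k' x)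
  (G := fun t => lstat k t * lstat k' t) _ _) _ => //.
by rewrite Rintegral_lstat_cov -/(second_moment k k') expr2 mulrCA.
Qed.

End ustatistic.

(** * The views of distinct individuals are independent *)

Section zip_tuples.
Context d1 d2 d3 (T : measurableType d1) (U : measurableType d2)
  (V : measurableType d3) (R : realType) (h : {mfun (T * U)%type >-> V}).

Definition zip_map n (z : n.-tuple T * n.-tuple U) : n.-tuple V :=
  [tuple h (tnth z.1 i, tnth z.2 i) | i < n].

Lemma measurable_zip_map n : measurable_fun setT (@zip_map n).
Proof.
apply/measurable_fun_tnthP => i.
rewrite (_ : _ \o _ = fun z => h (tnth z.1 i, tnth z.2 i)); last first.
  by apply/funext => z /=; rewrite tnth_mktuple.
apply: measurableT_comp => //; apply: measurable_fun_pair.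
  exact: measurableT_comp (measurable_tnth _) measurable_fst.
exact: measurableT_comp (measurable_tnth _) measurable_snd.
Qed.

Lemma zip_map_cons n x w (xs : n.-tuple T) (ws : n.-tuple U) :
  zip_map (pair_cons (x, xs), pair_cons (w, ws)) =
  pair_cons (h (x, w), zip_map (xs, ws)).
Proof.
apply: eq_from_tnth => i; rewrite tnth_mktuple/= /pair_cons.
by case: (unliftP ord0 i) => [j|] ->; rewrite ?tnthS ?tnth0// tnth_mktuple.
Qed.

Variables (P : probability T R) (Q : probability U R).
Local Open Scope ereal_scope.

Lemma ge0_integral_iidS d (W : measurableType d) (M : probability W R) n
    (F : n.+1.-tuple W -> \bar R) :
  measurable_fun setT F -> (forall t, 0 <= F t) ->
  \int[iid_prob M n.+1]_t F t =
  \int[M]_x \int[iid_prob M n]_t F (pair_cons (x, t)).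
Proof.
move=> mF F0; rewrite ge0_integral_distribution//.
rewrite (fubini_tonelli1 (F \o @pair_cons _ W n))//; last first.
  by move=> z; exact: F0.
exact: measurableT_comp mF (@measurable_pair_cons _ W n).
Qed.

(** Pairing the i-th entry of an iid sample of law [P] with the i-th entry of an
independent iid sample of law [Q] gives an iid sample. For nonnegative functions
Tonelli allows the second [P]-sample integral and the first [Q]-integral to be
exchanged freely, so the induction needs no integrability. *)
Lemma ge0_integral_zip_map n (F : n.-tuple V -> \bar R) :
  measurable_fun setT F -> (forall t, 0 <= F t) ->
  \int[iid_prob P n \x iid_prob Q n]_z F (zip_map z) =
  \int[iid_prob (distribution (P \x Q) h) n]_t F t.
Proof.
elim: n F => [|n ih] F mF F0.
  rewrite (eq_integral (cst (F [tuple]))); last first.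
    by move=> z _; congr F; rewrite [LHS]tuple0.
  rewrite [RHS](eq_integral (cst (F [tuple]))); last first.
    by move=> z _; congr F; rewrite [LHS]tuple0.
  rewrite !integral_cst//; congr (_ * _).
  apply: etrans (esym (probability_setT
    (iid_prob (distribution (P \x Q) h) 0))).
  exact: (probability_setT [the probability _ _ of
    (iid_prob P 0 \x iid_prob Q 0)%E]).
have mG : measurable_fun setT (F \o @zip_map n.+1).
  exact: measurableT_comp mF (@measurable_zip_map _).
have mcons d (W : measurableType d) := @measurable_pair_cons _ W n.
have mFc : measurable_fun setT (F \o @pair_cons _ V n).
  exact: measurableT_comp mF (mcons _ V).
have Fc0 z : 0 <= (F \o @pair_cons _ V n) z by exact: F0.
have mcomp d (W : measurableType d) (a : W -> T) (b : W -> n.-tuple T)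
    (c : W -> U) (e : W -> n.-tuple U) :
    measurable_fun setT a -> measurable_fun setT b ->
    measurable_fun setT c -> measurable_fun setT e ->
    measurable_fun setT (fun w =>
      F (zip_map (pair_cons (a w, b w), pair_cons (c w, e w)))).
  move=> ma mb mc me; apply: (measurableT_comp mG).
  apply: measurable_fun_pair.
    exact: measurableT_comp (mcons _ T) (measurable_fun_pair ma mb).
  exact: measurableT_comp (mcons _ U) (measurable_fun_pair mc me).
rewrite (fubini_tonelli1 (F \o @zip_map n.+1))//= /fubini_F.
rewrite ge0_integral_iidS//; last 2 first.
- by apply: (measurable_fun_fubini_tonelli_F (F \o @zip_map n.+1) mG) => z;
    exact: F0.
- by move=> t; apply: integral_ge0 => y _; exact: F0.
rewrite [RHS]ge0_integral_iidS//.
rewrite [RHS]ge0_integral_distribution; last 2 first.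
- exact: (measurable_fun_fubini_tonelli_F (F \o @pair_cons _ V n) mFc Fc0).
- by move=> v /=; apply: integral_ge0 => y _; exact: F0.
rewrite [RHS]fubini_tonelli1//; last 2 first.
- by apply: (measurableT_comp (measurable_fun_fubini_tonelli_F
    (F \o @pair_cons _ V n) mFc Fc0)).
- by move=> v /=; apply: integral_ge0 => y _; exact: F0.
apply: eq_integral => x _; rewrite /fubini_F/=.
under eq_integral => xs _.
  rewrite (@ge0_integral_iidS _ _ _ n
      (fun ws => F (zip_map (pair_cons (x, xs), ws))))//; last first.
    by apply: (measurableT_comp mG); exact: measurable_fun_pair.
  over.
rewrite (@fubini_tonelli _ _ _ _ _ _ _ (fun z =>
  \int[iid_prob Q n]_ws F (zip_map (pair_cons (x, z.1), pair_cons (z.2, ws)))));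
  last 2 first.
- apply: (measurable_fun_fubini_tonelli_F (fun z : (n.-tuple T * U) * n.-tuple U =>
    F (zip_map (pair_cons (x, z.1.1), pair_cons (z.1.2, z.2))))); last first.
    by move=> z; exact: F0.
  apply: mcomp => //.
  + exact: measurableT_comp measurable_fst measurable_fst.
  + exact: measurableT_comp measurable_snd measurable_fst.
- by move=> z; apply: integral_ge0 => y _; exact: F0.
apply: eq_integral => w _.
pose H (t : n.-tuple V) := F (pair_cons (h (x, w), t)).
have mH : measurable_fun setT H.
  by apply: (measurableT_comp mF); apply: measurableT_comp (mcons _ V) _;
    exact: measurable_fun_pair.
rewrite -[RHS](ih H)//; last by move=> t; exact: F0.
rewrite (fubini_tonelli1 (fun z => H (zip_map z)))//; last 2 first.
- by apply: measurableT_comp mH _; exact: measurable_zip_map.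
- by move=> z; exact: F0.
apply: eq_integral => xs _; apply: eq_integral => ws _.
by rewrite zip_map_cons.
Qed.

End zip_tuples.

Section single_view.
Context {R : realType}.
Implicit Types (alpha : R) (f : density R).

Definition view alpha L (z : measurableTypeR R * L.-tuple (measurableTypeR R)) :
    L.-tuple (measurableTypeR R) :=
  [tuple phi L k z.1 + sigma alpha L * tnth z.2 k | k < L].

Lemma measurable_view alpha L : measurable_fun setT (@view alpha L).
Proof.
apply/measurable_fun_tnthP => k.
rewrite (_ : _ \o _ = fun z : measurableTypeR R * L.-tuple (measurableTypeR R) =>
    phi L k z.1 + sigma alpha L * tnth z.2 k); last first.
  by apply/funext => w /=; rewrite !tnth_mktuple.
apply: measurable_funD.
  by apply: (@measurableT_comp _ _ _ _ _ _ (phi L k)); first exact: measurable_phi.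
apply: measurable_funM => //.
by apply: (measurableT_comp (measurable_tnth _)); exact: measurable_snd.
Qed.

HB.instance Definition _ alpha L :=
  isMeasurableFun.Build _ _ _ _ (@view alpha L) (@measurable_view alpha L).

Definition view_prob alpha f L : probability (L.-tuple (measurableTypeR R)) R :=
  distribution (density_prob f \x iid_prob laplace_prob L)%E (@view alpha L).

(** The sample space lists all the [X_i] before all the noises; regrouped by
individual, the views become iid, which is the setting of the U-statistic. *)
Lemma views_prob_iid alpha f L n A : measurable A ->
  views_prob alpha f L n A = iid_prob (view_prob alpha f L) n A.
Proof.
move=> mA.
have -> : views_prob alpha f L n A =
    (\int[sample_prob f L n]_z (\1_A (views alpha z))%:E)%E.
  transitivity (\int[sample_prob f L n]_z (\1_(@views _ alpha L n @^-1` A) z)%:E)%E.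
    by rewrite integral_indic ?setIT// -[X in measurable X]setTI;
      exact: measurable_views.
  by apply: eq_integral => z _; rewrite !indicE.
transitivity (\int[iid_prob (view_prob alpha f L) n]_t (\1_A t)%:E)%E; last first.
  by rewrite integral_indic// setIT.
have m1 : measurable_fun setT (fun t : n.-tuple (L.-tuple (measurableTypeR R)) =>
    (\1_A t : R)%:E) by apply/measurable_EFinP; exact: measurable_indic.
have := @ge0_integral_zip_map _ _ _ _ _ _ R (@view alpha L) (density_prob f)
  (iid_prob laplace_prob L) n _ m1.
by apply => t; rewrite lee_fin.
Qed.

End single_view.

(** * Moments of the Laplace law *)

Section density_integral.
Local Open Scope ereal_scope.
Context d (T : measurableType d) (R : realType).
Variables (mu nu : {measure set T -> \bar R}) (g : T -> R).
Hypothesis mg : measurable_fun setT g.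
Hypothesis g0 : forall x, (0 <= g x)%R.
Hypothesis nuE : forall A, measurable A -> nu A = \int[mu]_(x in A) (g x)%:E.

Import HBNNSimple.

Let integral_density_nnsfun (h : {nnsfun T >-> R}) :
  \int[nu]_x (h x)%:E = \int[mu]_x ((h x)%:E * (g x)%:E).
Proof.
under [LHS]eq_integral do rewrite fimfunE -fsumEFin//.
rewrite [LHS]ge0_integral_fsum//; last 2 first.
- by move=> r; exact/measurable_EFinP/measurableT_comp.
- by move=> n x _; rewrite EFinM nnfun_muleindic_ge0.
under [RHS]eq_integral.
  move=> x xD; rewrite fimfunE -fsumEFin// ge0_mule_fsuml; last first.
    by move=> r; rewrite EFinM nnfun_muleindic_ge0.
  over.
rewrite [RHS]ge0_integral_fsum//; last 2 first.
- move=> r; apply: emeasurable_funM; last exact/measurable_EFinP.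
  exact/measurable_EFinP/measurableT_comp.
- move=> n x _; apply: mule_ge0; last by rewrite lee_fin.
  by rewrite EFinM nnfun_muleindic_ge0.
apply: eq_fsbigr => r _; rewrite integralZl_indic_nnsfun// integral_indic// setIT.
have [rN|r0] := ltP r 0%R.
  rewrite preimage_nnfun0// measure0 mule0 integral0_eq// => x _.
  by rewrite indicE in_set0 mulr0 mul0e.
under [RHS]eq_integral do rewrite EFinM -muleA.
rewrite ge0_integralZl//; last 2 first.
- by apply: emeasurable_funM; exact/measurable_EFinP.
- by move=> x _; rewrite mule_ge0// lee_fin.
rewrite nuE//; congr (_ * _); rewrite integral_mkcond; apply: eq_integral => x _.
by rewrite patchE indicE; case: ifPn => _; rewrite ?mul1e ?mul0e.
Qed.

(** By definition for indicators, hence for simple functions, and by monotone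
convergence in general. *)
Lemma ge0_integral_density (f : T -> \bar R) :
  measurable_fun setT f -> (forall x, 0 <= f x) ->
  \int[nu]_x f x = \int[mu]_x (f x * (g x)%:E).
Proof.
move=> mf f0; pose f_ := nnsfun_approx measurableT mf.
transitivity (lim (\int[nu]_x (f_ n x)%:E @[n --> \oo])).
  rewrite -monotone_convergence//=.
  - apply: eq_integral => ? /[!inE] xD; apply/esym/cvg_lim => //=.
    exact: cvg_nnsfun_approx.
  - by move=> n; exact/measurable_EFinP/measurable_funTS.
  - by move=> n ? _; rewrite lee_fin.
  - by move=> ? _ ? ? mn; rewrite lee_fin; exact/lefP/nd_nnsfun_approx.
transitivity (lim (\int[mu]_x ((f_ n x)%:E * (g x)%:E) @[n --> \oo])).
  by apply: congr_lim; apply/funext => n; exact: integral_density_nnsfun.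
rewrite -monotone_convergence//=.
- apply: eq_integral => x _; apply/cvg_lim => //=.
  by apply: cvgeZr => //; exact: cvg_nnsfun_approx.
- by move=> n; apply: emeasurable_funM; exact/measurable_EFinP.
- by move=> n x _; rewrite mule_ge0// lee_fin.
- move=> x _ a b ab; rewrite lee_wpmul2r ?lee_fin//.
  exact/lefP/nd_nnsfun_approx.
Qed.

End density_integral.

Section laplace_moments.
Context {R : realType}.
Local Notation mu := (@lebesgue_measure R).
Local Notation lap := (@laplace_prob R).

Lemma ge0_integral_oppr (f : R -> \bar R) :
  measurable_fun setT f -> (forall x, 0 <= f x)%E ->
  (\int[mu]_x f (- x)%R = \int[mu]_x f x)%E.
Proof.
move=> mf f0.
transitivity (\int[pushforward mu (-%R : R -> measurableTypeR R)]_x f x)%E.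
  by rewrite ge0_integral_pushforward.
by apply: eq_measure_integral => A mA _; exact: lebesgue_measureN.
Qed.

Lemma ge0_integral_laplace (f : measurableTypeR R -> \bar R) :
  measurable_fun setT f -> (forall x, 0 <= f x)%E ->
  (\int[lap]_x f x = \int[mu]_x (f x * (laplace_pdf x)%:E))%E.
Proof.
move=> mf f0; apply: ge0_integral_density => //.
- exact: measurable_laplace_pdf.
- exact: laplace_pdf_ge0.
Qed.

Lemma ge0_integral_laplace_oppr (f : measurableTypeR R -> \bar R) :
  measurable_fun setT f -> (forall x, 0 <= f x)%E ->
  (\int[lap]_x f (- x)%R = \int[lap]_x f x)%E.
Proof.
move=> mf f0; rewrite !ge0_integral_laplace//; last first.
  exact: (measurableT_comp mf (@oppr_measurable R setT)).
rewrite -[RHS](ge0_integral_oppr (f := fun x => f x * (laplace_pdf x)%:E)%E).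
- by apply: eq_integral => x _; rewrite /laplace_pdf normrN.
- apply: emeasurable_funM => //; apply/measurable_EFinP.
  exact: measurable_laplace_pdf.
- by move=> x; rewrite mule_ge0// lee_fin laplace_pdf_ge0.
Qed.

(** Half of the exponential decay absorbs the factor [x ^ 2], which bounds the
second moment of the Laplace law by the total mass of two exponential laws. *)
Lemma sqr_laplace_pdf_le (x : R) :
  x ^+ 2 * laplace_pdf x <= 8 *
    (exponential_pdf (Num.sqrt 2 / 2) x + exponential_pdf (Num.sqrt 2 / 2) (- x)).
Proof.
wlog x0 : x / 0 <= x.
  move=> H; have [/H//|/ltW x0] := leP 0 x.
  have := H (- x); rewrite oppr_ge0 opprK sqrrN {1}/laplace_pdf normrN => /(_ x0).
  by rewrite [X in _ <= 8 * X]addrC.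
set s := Num.sqrt 2; have s0 : 0 < s by rewrite sqrtr_gt0.
have r0 : 0 <= s / 2 by rewrite divr_ge0// ltW.
apply: (@le_trans _ _ (8 * exponential_pdf (s / 2) x)); last first.
  by rewrite ler_wpM2l// lerDl exponential_pdf_ge0.
rewrite exponential_pdfE// /laplace_pdf ger0_norm//= -/s.
have ss : s ^+ 2 = 2 by rewrite sqr_sqrtr.
have sV : s^-1 = s / 2.
  by apply: (mulfI (lt0r_neq0 s0)); rewrite mulfV ?lt0r_neq0// mulrA -expr2 ss divff.
pose t := s / 2 * x.
have t0 : 0 <= t by rewrite mulr_ge0.
have -> : x ^+ 2 = 2 * t ^+ 2 by rewrite /t !exprMn ss; field.
have -> : - (s * x) = - t + - t by rewrite /t; field.
rewrite sV expRD mulNr -/t.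
have et : t ^+ 2 * expR (- t) <= 4.
  rewrite expRN ler_pdivrMr ?expR_gt0//.
  (* squaring 1 + t / 2 <= exp (t / 2) gives t ^ 2 <= 4 exp t *)
  have h : 1 + t / 2 <= expR (t / 2) by exact: expR_ge1Dx.
  have -> : expR t = expR (t / 2) ^+ 2.
    by rewrite expr2 -expRD; congr expR; field.
  have : (1 + t / 2) ^+ 2 <= expR (t / 2) ^+ 2.
    by rewrite ler_sqr ?nnegrE ?expR_ge0// addr_ge0// divr_ge0.
  have : t ^+ 2 <= 4 * (1 + t / 2) ^+ 2 by nra.
  by lra.
have -> : 2 * t ^+ 2 * (s / 2 * (expR (- t) * expR (- t))) =
  (t ^+ 2 * expR (- t)) * (2 * (s / 2 * expR (- t))) by ring.
have -> : 8 * (s / 2 * expR (- t)) = 4 * (2 * (s / 2 * expR (- t))) by ring.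
by apply: ler_wpM2r => //; rewrite mulr_ge0// mulr_ge0// expR_ge0.
Qed.

Lemma Lfun2_laplace : (fun x : measurableTypeR R => x) \in Lfun lap 2%:E.
Proof.
apply/Lfun2P; split; first exact: measurable_id.
have m2 : measurable_fun setT (fun x : measurableTypeR R => (x ^+ 2)%:E).
  by apply/measurable_EFinP; exact: measurable_funX.
apply/integrableP; split=> //.
under eq_integral do rewrite gee0_abs ?lee_fin ?sqr_ge0//.
rewrite ge0_integral_laplace//; last by move=> x; rewrite lee_fin sqr_ge0.
have r0 : 0 < Num.sqrt 2 / 2 :> R by rewrite divr_gt0// sqrtr_gt0.
have mE : measurable_fun setT (EFin \o exponential_pdf (Num.sqrt 2 / 2 : R)).
  by apply/measurable_EFinP; exact: measurable_exponential_pdf.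
have mEN : measurable_fun setT
    (fun x : R => (exponential_pdf (Num.sqrt 2 / 2 : R) (- x))%:E).
  by apply: (measurableT_comp mE); exact: oppr_measurable.
have E0 x : (0 <= (exponential_pdf (Num.sqrt 2 / 2 : R) x)%:E)%E.
  by rewrite lee_fin exponential_pdf_ge0// ltW.
apply: (@le_lt_trans _ _ (\int[mu]_x (8%:E *
    ((exponential_pdf (Num.sqrt 2 / 2 : R) x)%:E +
     (exponential_pdf (Num.sqrt 2 / 2 : R) (- x))%:E)))%E).
  apply: ge0_le_integral => //.
  - by move=> x _; rewrite mule_ge0// lee_fin ?sqr_ge0// laplace_pdf_ge0.
  - apply: emeasurable_funM => //; apply/measurable_EFinP.
    exact: measurable_laplace_pdf.
  - by apply: emeasurable_funM => //; exact: emeasurable_funD.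
  - by move=> x _; rewrite -EFinM -EFinD -EFinM lee_fin sqr_laplace_pdf_le.
rewrite ge0_integralZl//; last 2 first.
- exact: emeasurable_funD.
- by move=> x _; rewrite adde_ge0.
rewrite ge0_integralD// (@ge0_integral_oppr (EFin \o exponential_pdf _))//.
by rewrite integral_exponential_pdf// -EFinD -EFinM ltry.
Qed.

(** The positive and the negative part have the same integral by symmetry. *)
Lemma Rintegral_laplace : \int[lap]_x x = 0.
Proof.
rewrite /Rintegral integralE.
have mpos : measurable_fun setT ((@EFin R) ^\+%E : measurableTypeR R -> \bar R).
  exact: measurable_funepos.
rewrite (_ : (\int[lap]_x (EFin ^\-)%E x)%E = (\int[lap]_x (EFin ^\+)%E x)%E).
  rewrite subee//; apply: integrable_fin_num => //.
  by apply: integrable_funepos => //; exact/Lfun2_integrable/Lfun2_laplace.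
rewrite -[RHS]ge0_integral_laplace_oppr//.
by apply: eq_integral => x _; rewrite funenegE funeposE/= EFinN.
Qed.

End laplace_moments.

(** * Coordinates of an iid sample *)

Section iid_coordinates.
Context d (T : measurableType d) (R : realType) (P : probability T R).
Implicit Types F G : T -> R.

Let tnth_cons n (x : T) (t : n.-tuple T) (i : 'I_n.+1) F :
  F (tnth (pair_cons (x, t)) i) =
  if unlift ord0 i is Some j then F (tnth t j) else F x.
Proof.
by rewrite /pair_cons; case: unliftP => [j|] ->; rewrite ?tnthS ?tnth0.
Qed.

Let Lfun2_tnth_cons n (i : 'I_n.+1) F :
  (forall j : 'I_n, (fun t => F (tnth t j)) \in Lfun (iid_prob P n) 2%:E) ->
  F \in Lfun P 2%:E ->
  (fun z => F (tnth (@pair_cons _ _ n z) i)) \in Lfun (P \x iid_prob P n)%E 2%:E.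
Proof.
move=> ih L2F; rewrite (_ : (fun _ => _) = fun z : T * n.-tuple T =>
    if unlift ord0 i is Some j then F (tnth z.2 j) else F z.1); last first.
  by apply/funext => -[x t]; rewrite tnth_cons.
by case: unliftP => [j|] _; [exact: Lfun2_snd (ih j)|exact: Lfun2_fst].
Qed.

Lemma Lfun2_iid_tnth n (i : 'I_n) F : F \in Lfun P 2%:E ->
  (fun t : n.-tuple T => F (tnth t i)) \in Lfun (iid_prob P n) 2%:E.
Proof.
move=> L2F; have /Lfun2P[mF _] := L2F.
elim: n i => [[]//|n ih] i; apply: Lfun2_distribution.
  by apply: measurableT_comp mF _; exact: measurable_tnth.
exact: Lfun2_tnth_cons.
Qed.

Lemma integral_iid_tnth n (i : 'I_n) F : P.-integrable setT (EFin \o F) ->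
  (iid_prob P n).-integrable setT (EFin \o (fun t => F (tnth t i))) /\
  \int[iid_prob P n]_t F (tnth t i) = \int[P]_x F x.
Proof.
move=> iF; have mF : measurable_fun setT F.
  by apply/measurable_EFinP; case/integrableP: iF.
elim: n i => [[]//|n ih] i.
have mFi : measurable_fun setT (fun t : n.+1.-tuple T => F (tnth t i)).
  by apply: measurableT_comp mF _; exact: measurable_tnth.
have E : (fun z => F (tnth (pair_cons z) i)) = fun z : T * n.-tuple T =>
    if unlift ord0 i is Some j then F (tnth z.2 j) else F z.1.
  by apply/funext => -[x t]; rewrite tnth_cons.
have iE : (P \x iid_prob P n)%E.-integrable setT
    (EFin \o (fun z => F (tnth (@pair_cons _ _ n z) i))).
  rewrite E; case: unliftP => [j|] _; last exact: integrable_fst.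
  by apply: (integrable_snd _ (G := fun t => F (tnth t j))); case: (ih j).
split; first exact: integrable_distribution.
rewrite (Rintegral_distribution mFi)// E.
case: unliftP => [j|] _; last by rewrite Rintegral_fst.
have [ij <-] := ih j.
exact: (Rintegral_snd _ (G := fun t => F (tnth t j))).
Qed.

Lemma Rintegral_iid_tnthM n (i j : 'I_n) F G : i != j ->
  F \in Lfun P 2%:E -> G \in Lfun P 2%:E ->
  \int[iid_prob P n]_t (F (tnth t i) * G (tnth t j)) =
  \int[P]_x F x * \int[P]_x G x.
Proof.
move=> ij L2F L2G; have /Lfun2P[mF _] := L2F; have /Lfun2P[mG _] := L2G.
have iF := Lfun2_integrable L2F; have iG := Lfun2_integrable L2G.
elim: n i j ij => [[]//|n ih] i j ij.
rewrite (@Rintegral_distribution _ _ _ _ _ _ _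
    (fun t => F (tnth t i) * G (tnth t j))); last 2 first.
- by apply: measurable_funM; apply: measurableT_comp => //; exact: measurable_tnth.
- by apply: (Lfun2M_integrable (X := fun z => F (tnth (pair_cons z) i))
     (Y := fun z => G (tnth (pair_cons z) j)));
     apply: Lfun2_tnth_cons => // k; exact: Lfun2_iid_tnth.
transitivity (\int[(P \x iid_prob P n)%E]_z
    ((if unlift ord0 i is Some i' then F (tnth z.2 i') else F z.1) *
     (if unlift ord0 j is Some j' then G (tnth z.2 j') else G z.1))).
  by apply: eq_Rintegral => -[x t] _; rewrite !tnth_cons.
case: unliftP ij => [i' ->|->]; case: unliftP => [j' ->|->]; rewrite ?eqxx//.
- rewrite (inj_eq lift_inj) => ij; rewrite -(ih i' j' ij).
  apply: (Rintegral_snd _ (G := fun t => F (tnth t i') * G (tnth t j'))).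
  by apply: Lfun2M_integrable; exact: Lfun2_iid_tnth.
- move=> _; under eq_Rintegral do rewrite mulrC.
  rewrite mulrC -[X in _ * X](integral_iid_tnth i' iF).2.
  apply: (Rintegral_prod_mul (G := fun t => F (tnth t i'))) => //.
  exact/Lfun2_integrable/Lfun2_iid_tnth.
- move=> _; rewrite -[X in _ * X](integral_iid_tnth j' iG).2.
  apply: (Rintegral_prod_mul (G := fun t => G (tnth t j'))) => //.
  exact/Lfun2_integrable/Lfun2_iid_tnth.
Qed.

End iid_coordinates.

(** * Bins and the moments of one view *)

Section bins.
Context {R : realType}.
Implicit Types (f : density R) (L k : nat).

(** The interval on which [phi L k] does not vanish. *)
Definition bin L k : set R := [set x : R | 0 <= L%:R * x - k%:R < 1].

Lemma phiE L k (x : R) : phi L k x = Num.sqrt L%:R * \1_(bin L k) x.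
Proof.
by [].
Qed.

Lemma measurable_bin L k : measurable (bin L k : set (measurableTypeR R)).
Proof.
have mf : measurable_fun setT (fun x : R => L%:R * x - k%:R).
  by apply: measurable_funB => //; exact: measurable_funM.
rewrite (_ : bin L k = (fun x : R => L%:R * x - k%:R) @^-1` `[0, 1[); last first.
  by apply/seteqP; split=> x /=; rewrite in_itv.
by rewrite -[X in measurable X]setTI; exact: mf.
Qed.

Lemma bin_inj L k k' (x : R) : bin L k x -> bin L k' x -> k = k'.
Proof.
move=> /andP[h1 h2] /andP[h3 h4]; apply/eqP; rewrite eqn_leq.
by apply/andP; split; rewrite -ltnS -(ltr_nat R) -natr1; lra.
Qed.

Lemma sum_indic_bin L (F : 'I_L -> R) (k : 'I_L) (x : R) : bin L k x ->
  \sum_j F j * \1_(bin L j) x = F k.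
Proof.
move=> xk; rewrite (bigD1 k)//= indicE mem_set// mulr1.
rewrite big1 ?addr0// => j jk; rewrite indicE memNset ?mulr0// => xj.
by move/eqP: jk; apply; apply/val_inj; exact: bin_inj xj xk.
Qed.

Lemma sum_indic_bin_out L (F : 'I_L -> R) (x : R) :
  ~ (exists k : 'I_L, bin L k x) -> \sum_j F j * \1_(bin L j) x = 0.
Proof.
move=> nx; rewrite big1// => k _; rewrite indicE memNset ?mulr0// => xk.
by apply: nx; exists k.
Qed.

Lemma sum_indic_bin_le1 L (x : R) : \sum_(k < L) \1_(bin L k) x <= 1 :> R.
Proof.
under eq_bigr do rewrite -[\1_ _ _]mul1r.
have [[k xk]|nx] := pselect (exists k : 'I_L, bin L k x).
  by rewrite (sum_indic_bin (fun=> 1) xk).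
by rewrite (sum_indic_bin_out (fun=> 1) nx).
Qed.

Definition mass f L k : R := fine (density_prob f (bin L k)).

Lemma Lfun2_indic (P : probability (measurableTypeR R) R) A : measurable A ->
  (\1_A : measurableTypeR R -> R) \in Lfun P 2%:E.
Proof.
move=> mA; apply/Lfun2P; split; first exact: measurable_indic.
under eq_fun do rewrite indicE -natrX expnS expn1 mulnb andbb -indicE.
exact: integrable_indic.
Qed.

Lemma Rintegral_indic f A : measurable A ->
  \int[density_prob f]_x \1_A x = fine (density_prob f A).
Proof. by move=> mA; rewrite /Rintegral integral_indic ?setIT. Qed.

Lemma mass_ge0 f L k : 0 <= mass f L k.
Proof. exact: fine_ge0. Qed.

Lemma sum_mass_le1 f L : \sum_(k < L) mass f L k <= 1.
Proof.
have L2 k := Lfun2_indic (density_prob f) (measurable_bin L k).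
have i1 (k : 'I_L) := Lfun2_integrable (L2 k).
rewrite (eq_bigr (fun k : 'I_L => \int[density_prob f]_x \1_(bin L k) x)).
  2: by move=> k _; rewrite Rintegral_indic//; exact: measurable_bin.
rewrite -Rintegral_sum//.
rewrite -[leRHS](Rintegral_cst1 (density_prob f) 1); apply: le_Rintegral => //.
- exact: integrable_sumR.
- exact: finite_measure_integrable_cst.
- by move=> x _; exact: sum_indic_bin_le1.
Qed.

Lemma mass_le1 f L (k : 'I_L) : mass f L k <= 1.
Proof.
apply: le_trans (sum_mass_le1 f L); rewrite (bigD1 k)//= lerDl.
by apply: sumr_ge0 => k' _; exact: mass_ge0.
Qed.

Lemma Lfun2_phi f L k :
  (phi L k : measurableTypeR R -> R) \in Lfun (density_prob f) 2%:E.
Proof.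
rewrite (_ : phi L k = fun x => Num.sqrt L%:R * \1_(bin L k) x); last first.
  by apply/funext => x; rewrite phiE.
by apply/Lfun2Z/Lfun2_indic; exact: measurable_bin.
Qed.

Lemma Rintegral_phi f L k :
  \int[density_prob f]_x phi L k x = Num.sqrt L%:R * mass f L k.
Proof.
under eq_Rintegral do rewrite phiE.
rewrite RintegralZl ?Rintegral_indic//; first exact: measurable_bin.
by apply/Lfun2_integrable/Lfun2_indic; exact: measurable_bin.
Qed.

Lemma Rintegral_phiM f L (k k' : 'I_L) :
  \int[density_prob f]_x (phi L k x * phi L k' x) =
  (k == k')%:R * (L%:R * mass f L k).
Proof.
have [<-|kk'] := eqVneq k k'.
  under eq_Rintegral => x _.
    rewrite !phiE mulrACA -expr2 sqr_sqrtr// indicE -natrM mulnb andbb -indicE.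
    over.
  rewrite mul1r RintegralZl ?Rintegral_indic//; first exact: measurable_bin.
  by apply/Lfun2_integrable/Lfun2_indic; exact: measurable_bin.
rewrite mul0r; under eq_Rintegral => x _.
  rewrite !phiE mulrACA !indicE -natrM mulnb (_ : _ && _ = false) ?mulr0; first over.
  apply/negbTE/negP => /andP[/set_mem xk /set_mem xk'].
  by move/eqP: kk'; apply; apply/val_inj; exact: bin_inj xk xk'.
by rewrite Rintegral_cst1.
Qed.

Definition binint L k (g : R -> R) : R :=
  \int[lebesgue_measure]_(x in `[0%R, 1%R] `&` bin L k) g x.

Lemma massE f L k : mass f L k = binint L k f.
Proof. by rewrite /mass /binint setIC. Qed.

Lemma integrable_density f :
  (@lebesgue_measure R).-integrable (`[0, 1]%classic : set R) (EFin \o f).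
Proof.
apply/integrableP; split; first by apply/measurable_EFinP; exact: measurable_density.
rewrite (_ : (\int[_]_(x in _) _ = 1)%E) ?ltry//.
rewrite -(integral_density f); apply: eq_integral => x; rewrite inE/= => x01.
by rewrite /= ger0_norm// density_ge0//; move: x01; rewrite in_itv.
Qed.

Lemma alpha0E f L k : alpha0 f L k = Num.sqrt L%:R * mass f L k.
Proof.
have mb : measurable (bin L k) := measurable_bin L k.
rewrite /alpha0 massE /binint Rintegral_mkcondr -RintegralZl//; last first.
  rewrite (_ : EFin \o _ = (EFin \o f) \_ (bin L k)).
    apply/integrable_restrict => //.
    by apply: integrableS (integrable_density f) => //; exact: measurableI.
  by apply/funext => x /=; rewrite !patchE; case: ifPn.
apply: eq_Rintegral => x _; rewrite phiE -mulrA; congr (_ * _).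
by rewrite patchE indicE; case: ifPn => _; rewrite ?mul1r ?mul0r.
Qed.

End bins.

Section view_moments.
Context {R : realType}.
Implicit Types (alpha : R) (f : density R).

(** Kept symbolic: the variance of the noise is absorbed in the final
constant. *)
Definition laplace_var : R := \int[@laplace_prob R]_x (x ^+ 2).

Lemma laplace_var_ge0 : 0 <= laplace_var.
Proof. by apply: Rintegral_ge0 => x _; exact: sqr_ge0. Qed.

Definition noise f L (k : 'I_L) (z : L.-tuple (measurableTypeR R)) : R :=
  tnth z k - alpha0 f L k.

Lemma measurable_noise f L k : measurable_fun setT (@noise f L k).
Proof. by apply: measurable_funB => //; exact: measurable_tnth. Qed.

Let W L : probability (L.-tuple (measurableTypeR R)) R := iid_prob laplace_prob L.

Lemma Rintegral_laplaceM L (k k' : 'I_L) :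
  \int[W L]_w (tnth w k * tnth w k') = (k == k')%:R * laplace_var.
Proof.
have L2 := @Lfun2_laplace R.
have [<-|kk'] := eqVneq k k'; last first.
  rewrite (Rintegral_iid_tnthM kk' L2 L2).
  by rewrite [X in X * _](@Rintegral_laplace R) !mul0r.
rewrite mul1r /laplace_var.
have isq := Lfun2_integrable_sqr L2.
rewrite -[RHS](integral_iid_tnth k isq).2.
by apply: eq_Rintegral => w _; rewrite expr2.
Qed.


Let L2tnth L (k : 'I_L) :
  (fun w : L.-tuple (measurableTypeR R) => tnth w k) \in Lfun (W L) 2%:E.
Proof. exact: Lfun2_iid_tnth (@Lfun2_laplace R). Qed.

Let Rintegral_tnth L (k : 'I_L) : \int[W L]_w tnth w k = 0.
Proof.
have iL := Lfun2_integrable (@Lfun2_laplace R).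
by rewrite (integral_iid_tnth k iL).2 (@Rintegral_laplace R).
Qed.

Let cphi f L k (x : measurableTypeR R) : R := phi L k x - alpha0 f L k.

Let L2cphi f L k : cphi f L k \in Lfun (density_prob f) 2%:E.
Proof.
rewrite (_ : cphi f L k = fun x => phi L k x + cst (- alpha0 f L k) x)//.
by apply: Lfun2D; [exact: Lfun2_phi|exact: Lfun_cst].
Qed.

Let Rintegral_cphi f L k : \int[density_prob f]_x cphi f L k x = 0.
Proof.
rewrite RintegralB//.
- by rewrite Rintegral_cst1 Rintegral_phi alpha0E subrr.
- exact: Lfun2_integrable (Lfun2_phi _ _ _).
- exact: finite_measure_integrable_cst.
Qed.

Let Rintegral_cphiM f L (k k' : 'I_L) :
  \int[density_prob f]_x (cphi f L k x * cphi f L k' x) =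
  (k == k')%:R * (L%:R * mass f L k) - alpha0 f L k * alpha0 f L k'.
Proof.
have i1 j : (density_prob f).-integrable setT (EFin \o phi L j).
  exact: Lfun2_integrable (Lfun2_phi _ _ _).
have i0 : (density_prob f).-integrable setT
    (EFin \o (fun _ => alpha0 f L k * alpha0 f L k')).
  exact: finite_measure_integrable_cst.
have i2 := Lfun2M_integrable (Lfun2_phi f L k) (Lfun2_phi f L k').
have i3 := integrable_scaleR (- alpha0 f L k) (i1 k').
have i4 := integrable_scaleR (- alpha0 f L k') (i1 k).
have i34 := integrable_addR i3 i4.
have i340 := integrable_addR i34 i0.
transitivity (\int[density_prob f]_x (phi L k x * phi L k' x +
  (- alpha0 f L k * phi L k' x + - alpha0 f L k' * phi L k x +
   alpha0 f L k * alpha0 f L k'))).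
  by apply: eq_Rintegral => x _; rewrite /cphi/=; ring.
rewrite RintegralD// RintegralD// Rintegral_cst1 RintegralD//.
rewrite (RintegralZl _ measurableT (i1 k')) (RintegralZl _ measurableT (i1 k)).
by rewrite !Rintegral_phi Rintegral_phiM !alpha0E; ring.
Qed.

Let noise_view f alpha L k x w :
  @noise f L k (view alpha (x, w)) =
  cphi f L k x + sigma alpha L * tnth w k.
Proof. by rewrite /noise /view tnth_mktuple/= /cphi addrAC. Qed.

Let L2noise_view f alpha L k :
  (fun z => @noise f L k (view alpha z)) \in
    Lfun (density_prob f \x W L)%E 2%:E.
Proof.
rewrite (_ : (fun _ => _) = fun z => cphi f L k z.1 + sigma alpha L * tnth z.2 k).
  apply: Lfun2D; first exact: Lfun2_fst.
  by apply: Lfun2Z; exact: Lfun2_snd (L2tnth k).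
by apply/funext => -[x w]; rewrite noise_view.
Qed.

Lemma Lfun2_noise f alpha L k :
  @noise f L k \in Lfun (view_prob alpha f L) 2%:E.
Proof.
by apply: Lfun2_distribution; [exact: measurable_noise|exact: L2noise_view].
Qed.

Lemma Rintegral_noise f alpha L k :
  \int[view_prob alpha f L]_z @noise f L k z = 0.
Proof.
rewrite Rintegral_distribution; last 2 first.
- exact: measurable_noise.
- exact: Lfun2_integrable (L2noise_view _ _ _).
have i1 : (density_prob f \x W L)%E.-integrable setT
    (EFin \o (fun z => cphi f L k z.1)).
  exact/integrable_fst/Lfun2_integrable.
have i2 : (density_prob f \x W L)%E.-integrable setT
    (EFin \o (fun z => tnth z.2 k)).
  exact: integrable_snd (Lfun2_integrable (L2tnth k)).
have i3 := integrable_scaleR (sigma alpha L) i2.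
transitivity (\int[(density_prob f \x W L)%E]_z
    (cphi f L k z.1 + sigma alpha L * tnth z.2 k)).
  by apply: eq_Rintegral => -[x w] _; rewrite noise_view.
rewrite RintegralD// RintegralZl// Rintegral_fst; last exact: Lfun2_integrable.
rewrite (Rintegral_snd _ (Lfun2_integrable (L2tnth k))).
by rewrite Rintegral_cphi Rintegral_tnth mulr0 addr0.
Qed.

(** The bins are disjoint, so the products of distinct [phi L k] vanish, and the
covariance of a view is a diagonal matrix (bin masses plus Laplace variance)
minus the rank-one matrix of the means. *)
Lemma noise_cov f alpha L (k k' : 'I_L) :
  second_moment (@noise f L) (view_prob alpha f L) k k' =
  (k == k')%:R * (L%:R * mass f L k + sigma alpha L ^+ 2 * laplace_var)
  - alpha0 f L k * alpha0 f L k'.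
Proof.
rewrite /second_moment; set s := sigma alpha L.
rewrite (@Rintegral_distribution _ _ _ _ _ _ _
    (fun z => noise f k z * noise f k' z)); last 2 first.
- by apply: measurable_funM; exact: measurable_noise.
- exact: Lfun2M_integrable (L2noise_view _ _ _) (L2noise_view _ _ _).
have icc := Lfun2M_integrable (L2cphi f L k) (L2cphi f L k').
have iww := Lfun2M_integrable (L2tnth k) (L2tnth k').
have icw j (j' : 'I_L) : (density_prob f \x W L)%E.-integrable setT
    (EFin \o (fun z => cphi f L j z.1 * tnth z.2 j')).
  exact: integrable_prod_mul (Lfun2_integrable (L2cphi f L j))
    (Lfun2_integrable (L2tnth j')).
have i1 := integrable_fst (W L) icc.
have i2 := integrable_scaleR (s ^+ 2) (integrable_snd (density_prob f) iww).
have i3 := integrable_scaleR s (integrable_addR (icw k k') (icw k' k)).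
have i23 := integrable_addR i2 i3.
transitivity (\int[(density_prob f \x W L)%E]_z
    (cphi f L k z.1 * cphi f L k' z.1 +
     (s ^+ 2 * (tnth z.2 k * tnth z.2 k') +
      s * (cphi f L k z.1 * tnth z.2 k' + cphi f L k' z.1 * tnth z.2 k)))).
  by apply: eq_Rintegral => -[x w] _; rewrite !noise_view -/s/=; ring.
rewrite RintegralD// RintegralD//.
rewrite (RintegralZl _ measurableT (integrable_snd (density_prob f) iww)).
rewrite (RintegralZl _ measurableT (integrable_addR (icw k k') (icw k' k))).
rewrite (RintegralD measurableT (icw k k') (icw k' k)).
rewrite (Rintegral_fst _ icc) (Rintegral_snd _ iww) Rintegral_cphiM.
rewrite (Rintegral_prod_mul (Lfun2_integrable (L2cphi f L k))
  (Lfun2_integrable (L2tnth k'))).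
rewrite (Rintegral_prod_mul (Lfun2_integrable (L2cphi f L k'))
  (Lfun2_integrable (L2tnth k))).
by rewrite !Rintegral_cphi Rintegral_laplaceM; ring.
Qed.

End view_moments.

(** * Mean squared error of the statistic *)

Section lstat_linear.
Context d (T : measurableType d) (R : realType) (L : nat).
Variables (xi : 'I_L -> T -> R) (mu : probability T R) (m : 'I_L -> R).
Hypothesis mxi : forall k, measurable_fun setT (xi k).
Hypothesis L2xi : forall k, xi k \in Lfun mu 2%:E.
Hypothesis xi0 : forall k, \int[mu]_x xi k x = 0.

Lemma Rintegral_lstat_linear_sqr n :
  \int[iid_prob mu n]_t ((\sum_k m k * lstat xi k t) ^+ 2) =
  n%:R * \sum_k \sum_k' m k * m k' * second_moment xi mu k k'.
Proof.
have ill k k' : (iid_prob mu n).-integrable setT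
    (EFin \o (fun t => m k * m k' * (lstat xi k t * lstat xi k' t))).
  by apply: integrable_scaleR; apply: Lfun2M_integrable; exact: Lfun2_lstat.
transitivity (\int[iid_prob mu n]_t \sum_k \sum_k'
    (m k * m k' * (lstat xi k t * lstat xi k' t))).
  apply: eq_Rintegral => t _; rewrite expr2 big_distrlr/=.
  by apply: eq_bigr => k _; apply: eq_bigr => k' _; rewrite mulrACA.
rewrite Rintegral_sum => [|//|k _]; last exact: integrable_sumR.
rewrite mulr_sumr; apply: eq_bigr => k _.
rewrite Rintegral_sum// mulr_sumr; apply: eq_bigr => k' _.
rewrite RintegralZl//; last by apply: Lfun2M_integrable; exact: Lfun2_lstat.
by rewrite Rintegral_lstat_cov// mulrCA.
Qed.

End lstat_linear.

Section statistic.
Context {R : realType}.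
Implicit Types (alpha : R) (f : density R).
Local Notation tuples L n := (n.-tuple (L.-tuple (measurableTypeR R))).

(** The projection of [f - g] on the span of the [phi L k] has these coordinates,
and [energy] is its squared norm: the quantity that the statistic estimates. *)
Definition signal f g L (k : 'I_L) : R := alpha0 f L k - alpha0 g L k.

Definition energy f g L : R := \sum_(k < L) signal f g k ^+ 2.

Lemma sumD_neq n (F : 'I_n -> R) i : \sum_(l | l != i) F l = \sum_l F l - F i.
Proof. by rewrite [in RHS](bigD1 i)//= addrAC subrr add0r. Qed.

(** Hoeffding decomposition: the centered noises enter through a linear term and
a degenerate U-statistic. *)
Lemma Tstat_decomp f g L n (z : tuples L n) : (2 <= n)%N ->
  Tstat g z = energy f g L +
    (2 / n%:R * (\sum_k signal f g k * lstat (noise f (L := L)) k z)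
    + (n%:R * (n%:R - 1))^-1 * ustat (noise f (L := L)) z).
Proof.
move=> n2.
have n0 : n%:R != 0 :> R by rewrite pnatr_eq0 -lt0n (ltn_trans _ n2).
have n1 : n%:R - 1 != 0 :> R.
  by rewrite subr_eq0 -[1]/(1%:R) eqr_nat gtn_eqF.
rewrite /Tstat.
pose x k i := noise f k (tnth z i).
have E i l : \sum_(k < L) (tnth (tnth z i) k - alpha0 g L k) *
    (tnth (tnth z l) k - alpha0 g L k) =
    \sum_(k < L) x k i * x k l + (\sum_k signal f g k * x k i +
     \sum_k signal f g k * x k l) + energy f g L.
  rewrite /energy -!big_split/=; apply: eq_bigr => k _.
  by rewrite /x /noise /signal; ring.
under eq_bigr do under eq_bigr do rewrite E.
have -> : \sum_k signal f g k * lstat (noise f (L := L)) k z =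
    \sum_i \sum_k signal f g k * x k i.
  by rewrite exchange_big/=; apply: eq_bigr => k _; rewrite mulr_sumr.
set G := fun i => \sum_k signal f g k * x k i.
have -> : \sum_(i < n) \sum_(l < n | l != i)
     (\sum_(k < L) x k i * x k l + (G i + G l) + energy f g L) =
   ustat (noise f (L := L)) z + 2 * (n%:R - 1) * \sum_i G i +
   n%:R * (n%:R - 1) * energy f g L.
  have step i : \sum_(l < n | l != i)
      (\sum_(k < L) x k i * x k l + (G i + G l) + energy f g L) =
      \sum_(l < n | l != i) \sum_(k < L) x k i * x k l +
      ((n%:R - 1) * G i + (\sum_l G l - G i) + (n%:R - 1) * energy f g L).
    rewrite !big_split/= (sumD_neq (fun=> G i)) (sumD_neq G).
    rewrite (sumD_neq (fun=> energy f g L)) !sumr_const card_ord.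
    by rewrite -(mulr_natl (G i)) -(mulr_natl (energy f g L)); ring.
  under eq_bigr do rewrite step.
  rewrite big_split/= -/(ustat _ z) !big_split/= sumrN -!mulr_sumr.
  by rewrite !sumr_const card_ord -(mulr_natl (\sum_l G l))
    -(mulr_natl (energy f g L)); ring.
by field; rewrite n0 n1.
Qed.


Definition mean_norm f L : R := Num.sqrt (\sum_(k < L) alpha0 f L k ^+ 2).

(** The order of the standard deviation of the statistic under the null
hypothesis: the first term is due to the observations themselves, the second one
to the Laplace noise. *)
Definition noise_rate alpha L n : R :=
  Num.sqrt L%:R / n%:R + L%:R * Num.sqrt L%:R / (n%:R * alpha ^+ 2).

Section cov_bounds.
Variables (f : density R) (L : nat) (v2 : R).
Let al (k : 'I_L) := alpha0 f L k.
Let B := mean_norm f L.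
Let S (k k' : 'I_L) := (k == k')%:R * (L%:R * mass f L k + v2) - al k * al k'.

Let al_ge0 (k : 'I_L) : 0 <= al k.
Proof. by rewrite /al alpha0E mulr_ge0// mass_ge0. Qed.

Let B0 : 0 <= B. Proof. exact: sqrtr_ge0. Qed.

Let B2 : B ^+ 2 = \sum_k al k ^+ 2.
Proof. by rewrite sqr_sqrtr// sumr_ge0// => k _; exact: sqr_ge0. Qed.

Let al_le (k : 'I_L) : al k <= B.
Proof.
rewrite -(ler_sqr (al_ge0 k) B0) B2 (bigD1 k)//= lerDl.
by apply: sumr_ge0 => k' _; exact: sqr_ge0.
Qed.

Let massL (k : 'I_L) : L%:R * mass f L k = Num.sqrt L%:R * al k.
Proof. by rewrite /al alpha0E mulrA -expr2 sqr_sqrtr. Qed.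

Let B2_le : B ^+ 2 <= L%:R.
Proof.
rewrite B2; apply: (@le_trans _ _ (\sum_(k < L) L%:R * mass f L k)).
  apply: ler_sum => k _; rewrite /al alpha0E exprMn sqr_sqrtr//.
  rewrite ler_wpM2l// expr2 -[leRHS]mulr1 ler_wpM2l ?mass_ge0//.
  exact: mass_le1.
by rewrite -mulr_sumr -[leRHS]mulr1 ler_wpM2l// sum_mass_le1.
Qed.

(** The rank-one part of the covariance only decreases the quadratic form, and
each diagonal entry [L * mass] is [sqrt L] times a mean, hence at most
[sqrt L * mean_norm]. *)
Lemma cov_linear_le (m : 'I_L -> R) :
  \sum_k \sum_k' m k * m k' * S k k' <=
  (Num.sqrt L%:R * B + v2) * \sum_k m k ^+ 2.
Proof.
have -> : \sum_k \sum_k' m k * m k' * S k k' =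
    \sum_(k < L) (L%:R * mass f L k + v2) * m k ^+ 2 - (\sum_k m k * al k) ^+ 2.
  rewrite expr2 big_distrlr/= -sumrB; apply: eq_bigr => k _.
  under eq_bigr => k' _.
    rewrite /S mulrBr [X in _ - X]mulrACA; over.
  rewrite sumrB; congr (_ - _); first rewrite (bigD1 k)//= eqxx big1.
    by rewrite addr0 [true%:R](erefl : _ = 1) mul1r mulrC.
  by move=> k'; rewrite eq_sym => /negbTE ->; rewrite mul0r mulr0.
rewrite lerBlDr -[leLHS]addr0; apply: lerD; last exact: sqr_ge0.
rewrite mulr_sumr; apply: ler_sum => k _; rewrite ler_wpM2r ?sqr_ge0//.
by rewrite lerD2r massL ler_wpM2l// al_le.
Qed.

(** [mean_norm ^ 2 <= L] since the masses are at most one and add up to at most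
one; this turns the fourth power that comes from the rank-one part into
[L * mean_norm ^ 2]. *)
Lemma cov_square_le :
  \sum_k \sum_k' S k k' ^+ 2 <= 6 * L%:R * B ^+ 2 + 4 * L%:R * v2 ^+ 2.
Proof.
have h k k' : S k k' ^+ 2 <=
    (k == k')%:R * (4 * L%:R * al k ^+ 2 + 4 * v2 ^+ 2) +
    2 * (al k ^+ 2 * al k' ^+ 2).
  rewrite /S massL; set s := Num.sqrt L%:R.
  have s2 : s ^+ 2 = L%:R by rewrite sqr_sqrtr.
  case: (k == k'); last by rewrite !mul0r; nra.
  rewrite !mul1r -s2.
  rewrite -subr_ge0; set a := al k; set b := al k'.
  rewrite [leRHS](_ : _ =
     (s * a + v2 + a * b) ^+ 2 + 2 * (s * a - v2) ^+ 2); last by ring.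
  by apply: addr_ge0; [|apply: mulr_ge0 => //]; exact: sqr_ge0.
apply: (@le_trans _ _ (\sum_k (4 * L%:R * al k ^+ 2 + 4 * v2 ^+ 2 +
    2 * (al k ^+ 2 * B ^+ 2)))).
  apply: ler_sum => k _; apply: le_trans (ler_sum _ (fun k' _ => h k k')) _.
  rewrite big_split/= -!mulr_sumr -B2 lerD2r (bigD1 k)//= eqxx big1.
    by rewrite addr0 mul1r.
  by move=> k'; rewrite eq_sym => /negbTE ->; rewrite mul0r.
rewrite !big_split/= sumr_const card_ord -(mulr_natl (4 * v2 ^+ 2)).
rewrite -2!mulr_sumr -mulr_suml -B2.
have := B2_le; have := sqr_ge0 B; have := sqr_ge0 v2.
by set b := B ^+ 2; nra.
Qed.

End cov_bounds.

(** The two terms of the decomposition are separated by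
[(x + y) ^ 2 <= 2 * x ^ 2 + 2 * y ^ 2]. With [w = L / alpha ^ 2] and
[x = sqrt L / n] the noise rate is [x * (1 + w)] and the variance of the noise
is [8 * w] times that of the Laplace law, so each term of the bound is visible
as a product of [x], [w] and norms. *)
Lemma Tstat_mse f g alpha L n : (2 <= n)%N -> (0 < L)%N -> 0 < alpha ->
  (fun z : tuples L n => Tstat g z - energy f g L) \in
    Lfun (iid_prob (view_prob alpha f L) n) 2%:E /\
  \int[iid_prob (view_prob alpha f L) n]_z ((Tstat g z - energy f g L) ^+ 2) <=
  8 * energy f g L * noise_rate alpha L n * (mean_norm f L + 8 * laplace_var) +
  64 * noise_rate alpha L n ^+ 2 * (mean_norm f L + 8 * laplace_var) ^+ 2.
Proof.
move=> n2 L0 alpha_gt0.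
have mxi k := @measurable_noise R f L k.
have L2xi (k : 'I_L) := Lfun2_noise f alpha k.
have xi0 (k : 'I_L) := Rintegral_noise f alpha k.
set P := iid_prob _ n.
pose lin (z : tuples L n) := \sum_k signal f g k * lstat (noise f (L := L)) k z.
pose u (z : tuples L n) := ustat (noise f (L := L)) z.
have [L2u Eu] := ustat_sqr mxi L2xi xi0 n.
have L2lin : lin \in Lfun P 2%:E.
  by apply: Lfun2_sum => k _; apply: Lfun2Z; exact: Lfun2_lstat.
have Elin := Rintegral_lstat_linear_sqr (signal f g (L := L)) mxi L2xi xi0 n.
pose c : R := (n%:R * (n%:R - 1))^-1.
have E : (fun z : tuples L n => Tstat g z - energy f g L) =
    fun z => 2 / n%:R * lin z + c * u z.
  by apply/funext => z; rewrite (Tstat_decomp f)// addrAC subrr add0r.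
have L2T : (fun z : tuples L n => Tstat g z - energy f g L) \in Lfun P 2%:E.
  by rewrite E; apply: Lfun2D; exact: Lfun2Z.
split=> //.
have ilin := Lfun2_integrable_sqr L2lin.
have iu := Lfun2_integrable_sqr L2u.
have i1 := integrable_scaleR (2 * (2 / n%:R) ^+ 2) ilin.
have i2 := integrable_scaleR (2 * c ^+ 2) iu.
apply: (@le_trans _ _ (\int[P]_z
    (2 * (2 / n%:R) ^+ 2 * lin z ^+ 2 + 2 * c ^+ 2 * u z ^+ 2))).
  apply: le_Rintegral => //.
  - exact: Lfun2_integrable_sqr L2T.
  - exact: integrable_addR.
  - move=> z _; rewrite [X in X ^+ 2](congr1 (@^~ z) E) -subr_ge0.
    set A := 2 / n%:R; rewrite (_ : _ - _ = (A * lin z - c * u z) ^+ 2).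
      exact: sqr_ge0.
    by ring.
rewrite (RintegralD measurableT i1 i2) (RintegralZl _ measurableT ilin).
rewrite (RintegralZl _ measurableT iu) Elin Eu.
under eq_bigr do under eq_bigr do rewrite noise_cov.
under [X in _ + _ * (_ * X)]eq_bigr do under eq_bigr do rewrite noise_cov.
set v := laplace_var; have v0 : 0 <= v := laplace_var_ge0.
set w := L%:R / alpha ^+ 2.
have w0 : 0 <= w by rewrite divr_ge0// sqr_ge0.
have sigmaE : sigma alpha L ^+ 2 = 8 * w.
  rewrite /sigma !exprMn exprVn !sqr_sqrtr// /w; ring.
have v20 : 0 <= 8 * w * v by rewrite mulr_ge0// mulr_ge0.
rewrite sigmaE.
have Q1 := cov_linear_le f (8 * w * v) (signal f g (L := L)).
have Q2 := cov_square_le f L (8 * w * v).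
set q1 := (X in _ * (n%:R * X) + _); set q2 := (X in _ + _ * (_ * X)).
have n0 : 0 < n%:R :> R by rewrite ltr0n (ltn_trans _ n2).
have nge2 : 2 <= n%:R :> R by rewrite ler_nat.
pose s : R := Num.sqrt L%:R; have s2 : s ^+ 2 = L%:R by rewrite sqr_sqrtr.
have s1 : 1 <= s by rewrite -[leLHS]sqrtr1 ler_sqrt// ler1n.
pose x := s / n%:R; have xE : x = s / n%:R by [].
clearbody x.
have x0 : 0 <= x by rewrite xE divr_ge0// (le_trans ler01).
have qE : noise_rate alpha L n = x * (1 + w).
  rewrite /noise_rate -/s xE /w; field.
  by rewrite gt_eqF// gt_eqF.
set B := mean_norm f L; have B0 : 0 <= B by exact: sqrtr_ge0.
set a := energy f g L; have a0 : 0 <= a.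
  by apply: sumr_ge0 => k _; exact: sqr_ge0.
rewrite qE.
have q20 : 0 <= q2 by apply: sumr_ge0 => k _; apply: sumr_ge0 => k' _; exact: sqr_ge0.
have n10 : 0 < n%:R - 1 :> R by rewrite subr_gt0 (lt_le_trans _ nge2)// ltr1n.
have c0 : 0 <= c by rewrite invr_ge0 mulr_ge0// ltW.
(* n - 1 >= n / 2 *)
have cle : c <= 2 / n%:R ^+ 2.
  rewrite -[leRHS]invrK invfM invrK lef_pV2 ?posrE; [nra|nra|].
  by rewrite mulr_gt0// ?invr_gt0// exprn_gt0.
have -> : 2 * (2 / n%:R) ^+ 2 * (n%:R * q1) +
    2 * c ^+ 2 * (2 * (n%:R * (n%:R - 1)) * q2)
    = 8 * (n%:R^-1 * q1) + 4 * (c * q2).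
  rewrite /c; field; by rewrite !gt_eqF.
have nx : n%:R^-1 <= x by rewrite xE -[leLHS]mul1r ler_wpM2r// invr_ge0 ltW.
have nV0 : 0 <= n%:R^-1 :> R by rewrite invr_ge0 ltW.
apply: lerD.
  rewrite -!mulrA ler_wpM2l//.
  apply: (@le_trans _ _ (n%:R^-1 * ((s * B + 8 * w * v) * a))).
    exact: ler_wpM2l.
  rewrite (_ : n%:R^-1 * _ = a * (x * B + n%:R^-1 * (8 * w * v))); last first.
    by rewrite xE; ring.
  rewrite ler_wpM2l//.
  have : n%:R^-1 * (8 * w * v) <= x * (8 * w * v) by exact: ler_wpM2r.
  have : 0 <= x * w * B + 8 * x * v.
    by apply: addr_ge0; apply: mulr_ge0 => //; exact: mulr_ge0.
  by lra.
apply: (@le_trans _ _ (4 * (2 / n%:R ^+ 2 *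
    (6 * L%:R * B ^+ 2 + 4 * L%:R * (8 * w * v) ^+ 2)))).
  by rewrite ler_wpM2l// ler_pM.
rewrite -s2 (_ : 4 * _ = x ^+ 2 * (48 * B ^+ 2 + 2048 * (w * v) ^+ 2)); last first.
  by rewrite xE; field; rewrite gt_eqF.
rewrite [leRHS](_ : _ =
    x ^+ 2 * (64 * ((1 + w) ^+ 2 * (B + 8 * v) ^+ 2))); last by ring.
rewrite ler_wpM2l ?sqr_ge0//.
have h1 : 1 + w ^+ 2 <= (1 + w) ^+ 2 by nra.
have h2 : B ^+ 2 + 64 * v ^+ 2 <= (B + 8 * v) ^+ 2 by nra.
have h3 : (1 + w ^+ 2) * (B ^+ 2 + 64 * v ^+ 2) <= (1 + w) ^+ 2 * (B + 8 * v) ^+ 2.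
  apply: ler_pM => //; apply: addr_ge0 => //; try exact: sqr_ge0.
  by apply: mulr_ge0 => //; exact: sqr_ge0.
have h4 : 0 <= (w * B) ^+ 2 + v ^+ 2 + B ^+ 2 + (w * v) ^+ 2.
  by do !apply: addr_ge0; exact: sqr_ge0.
have := sqr_ge0 B; have := sqr_ge0 (w * v); have := sqr_ge0 (w * B); have := sqr_ge0 v.
move: h3; rewrite !exprMn; lra.
Qed.

End statistic.

(** * Dyadic projections of a square-integrable function *)

Section dyadic.
Context {R : realType}.
Local Notation mu := (@lebesgue_measure R).

Lemma bin_itv L k : (0 < L)%N ->
  bin L k = `[k%:R / L%:R, k.+1%:R / L%:R[%classic :> set R.
Proof.
move=> L0; have L0' : 0 < L%:R :> R by rewrite ltr0n.
apply/seteqP; split=> x; rewrite /bin/= in_itv/= ler_pdivrMr// ltr_pdivlMr//;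
  rewrite -natr1 mulrC => /andP[? ?]; apply/andP; split; lra.
Qed.

Lemma lebesgue_measure_bin L k : (0 < L)%N -> mu (bin L k) = (L%:R^-1)%:E.
Proof.
move=> L0; rewrite bin_itv// lebesgue_measure_itv/= lte_fin.
have L0' : 0 < L%:R :> R by rewrite ltr0n.
rewrite ltr_pM2r ?invr_gt0// ltr_nat ltnSn -EFinD -mulrBl -natr1.
by rewrite addrAC subrr add0r mul1r.
Qed.

Lemma bin_sub01 L k : (k < L)%N -> bin L k `<=` (`[0, 1[%classic : set R).
Proof.
move=> kL; have L0 : (0 < L)%N by exact: leq_ltn_trans kL.
have L0' : 0 < L%:R :> R by rewrite ltr0n.
rewrite bin_itv// => x /=; rewrite !in_itv/= => /andP[h1 h2]; apply/andP; split.
  by rewrite (le_trans _ h1)// divr_ge0.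
by rewrite (lt_le_trans h2)// ler_pdivrMr// mul1r ler_nat.
Qed.

Lemma bin_cover L (x : R) : (0 < L)%N -> 0 <= x < 1 ->
  exists k : 'I_L, bin L k x.
Proof.
move=> L0 /andP[x0 x1]; have L0' : 0 < L%:R :> R by rewrite ltr0n.
have Lx0 : 0 <= L%:R * x by rewrite mulr_ge0// ltW.
have /andP[h1 h2] := truncn_itv Lx0.
have kL : (Num.truncn (L%:R * x) < L)%N.
  by rewrite -(ltr_nat R) (le_lt_trans h1)// -[ltRHS]mulr1 ltr_pM2l.
exists (Ordinal kL); rewrite /bin/= subr_ge0 h1/= ltrBlDr addrC natr1.
exact: h2.
Qed.

(** The dyadic interval of length [2^-n] that contains [x], for every real [x]:
the differentiation theorem asks for a family that shrinks nicely to each point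
of the line. *)
Definition dyadic_cell (x : R) n : set R :=
  [set y | 0 <= 2 ^+ n * y - (Num.floor (2 ^+ n * x))%:~R < 1].

Lemma dyadic_cell_itv x n : dyadic_cell x n =
  `[(Num.floor (2 ^+ n * x))%:~R / 2 ^+ n,
    ((Num.floor (2 ^+ n * x))%:~R + 1) / 2 ^+ n[%classic.
Proof.
have p0 : 0 < 2 ^+ n :> R by rewrite exprn_gt0.
apply/seteqP; split=> y; rewrite /dyadic_cell/= in_itv/= ler_pdivrMr//
  ltr_pdivlMr// mulrC => /andP[? ?]; apply/andP; split; lra.
Qed.

Lemma lebesgue_measure_dyadic_cell x n :
  mu (dyadic_cell x n) = ((2 ^+ n)^-1)%:E.
Proof.
have p0 : 0 < 2 ^+ n :> R by rewrite exprn_gt0.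
rewrite dyadic_cell_itv lebesgue_measure_itv/= lte_fin.
rewrite ltr_pM2r ?invr_gt0// ltrDl ltr01 -EFinD -mulrBl.
by rewrite addrAC subrr add0r mul1r.
Qed.

Lemma dyadic_cell_nice x : nicely_shrinking x (dyadic_cell x).
Proof.
split=> [n|]; first by rewrite dyadic_cell_itv.
have p0 n : 0 < (2^-1 : R) ^+ n by rewrite exprn_gt0// invr_gt0.
exists (2, fun n => PosNum (p0 n)); split => //=.
- by apply: cvg_expr; rewrite ger0_norm ?invr_ge0// invf_lt1// ltr1n.
- move=> n y; rewrite /dyadic_cell/= => /andP[h1 h2].
  have := floor_itv (2 ^+ n * x) => /andP[h3 h4].
  have pn : 0 < 2 ^+ n :> R by rewrite exprn_gt0.
  rewrite exprVn /ball/= -(ltr_pM2l pn) mulfV ?gt_eqF//.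
  rewrite -[X in X * `|_|](gtr0_norm pn) -normrM mulrBr ltr_norml.
  move: h4; rewrite intrD => h4; apply/andP; split; lra.
- move=> n; rewrite lebesgue_measure_dyadic_cell lebesgue_measure_ball.
    by rewrite -EFinM lee_fin exprVn mulr_natl.
  exact: ltW.
Qed.

Lemma dyadic_cell_bin x n k : bin (2 ^ n) k x -> dyadic_cell x n = bin (2 ^ n) k.
Proof.
rewrite /bin/= natrX => /andP[h1 h2]; rewrite /dyadic_cell.
rewrite (_ : Num.floor _ = k%:Z)//.
apply/floor_def; rewrite intrD -pmulrn; apply/andP; split; lra.
Qed.

Definition dyadic_mean n (g : R -> R) (x : R) : R :=
  \sum_(k < (2 ^ n)%N) 2 ^+ n * binint (2 ^ n) k g * \1_(bin (2 ^ n) k) x.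

(** The squared norm of the projection of [g] on the functions that are constant
on the bins of length [2^-n]. *)
Definition proj_energy n (g : R -> R) : R :=
  2 ^+ n * \sum_(k < (2 ^ n)%N) binint (2 ^ n) k g ^+ 2.

Lemma dyadic_meanE n g (k : 'I_(2 ^ n)) x : bin (2 ^ n) k x ->
  dyadic_mean n g x = 2 ^+ n * binint (2 ^ n) k g.
Proof.
by move=> xk; rewrite /dyadic_mean
  (sum_indic_bin (fun j : 'I_(2 ^ n) => 2 ^+ n * binint (2 ^ n) j g) xk).
Qed.

Lemma measurable_dyadic_mean n g : measurable_fun setT (dyadic_mean n g).
Proof.
apply: measurable_sum => k; apply: measurable_funM => //.
by apply: measurable_indic; exact: measurable_bin.
Qed.

Lemma integral_dyadic_mean_sqr n g :
  (\int[mu]_(x in `[0%R, 1%R[) (dyadic_mean n g x ^+ 2)%:E =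
   (proj_energy n g)%:E)%E.
Proof.
have p0 : 0 < 2 ^+ n :> R by rewrite exprn_gt0.
transitivity (\int[mu]_(x in `[0%R, 1%R[) (\sum_(k < (2 ^ n)%N)
    ((2 ^+ n * binint (2 ^ n) k g) ^+ 2)%:E * (\1_(bin (2 ^ n) k) x)%:E))%E.
  apply: eq_integral => x; rewrite inE/= in_itv/= => x01.
  have [k xk] := bin_cover (expn_gt0 2 n) x01.
  under eq_bigr do rewrite -EFinM.
  rewrite sumEFin (dyadic_meanE _ xk).
  by rewrite (sum_indic_bin (fun j : 'I_(2 ^ n) => (2 ^+ n * binint (2 ^ n) j g) ^+ 2) xk).
rewrite ge0_integral_sum//; last 2 first.
- move=> k; apply: emeasurable_funM => //; apply/measurable_EFinP.
  by apply: measurable_indic; exact: measurable_bin.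
- by move=> k x _; rewrite mule_ge0// lee_fin// sqr_ge0.
rewrite /proj_energy mulr_sumr -sumEFin; apply: eq_bigr => k _.
rewrite ge0_integralZl//; last 2 first.
- apply/measurable_EFinP; apply: measurable_indic; exact: measurable_bin.
- by rewrite lee_fin sqr_ge0.
rewrite integral_indic//; last exact: measurable_bin.
rewrite setIidl; last exact: bin_sub01.
transitivity (((2 ^+ n * binint (2 ^ n) k g) ^+ 2)%:E * ((2 ^ n)%:R^-1)%:E)%E.
  by congr (_ * _)%E; apply: lebesgue_measure_bin; rewrite expn_gt0.
rewrite -EFinM natrX; congr EFin.
by field; rewrite gt_eqF.
Qed.

Lemma cvg_dyadic_mean g : mu.-integrable `[0, 1] (EFin \o g) ->
  {ae mu, forall x, 0 <= x < 1 -> dyadic_mean n g x @[n --> \oo] --> g x}.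
Proof.
move=> ig; have m01 : measurable (`[0, 1]%classic : set R) by [].
have locg := integrable_locally m01 ig.
have := lebesgue_differentiation locg.
apply: filter_app; first exact: (ae_filter_ringOfSetsType mu).
apply: aeW => x gx x01.
have := nice_lebesgue_differentiation dyadic_cell_nice locg gx.
have -> : (g \_ `[0, 1]) x = g x.
  rewrite patchE mem_set//= in_itv/=.
  by move: x01 => /andP[-> /ltW ->].
rewrite (_ : (fun n => _) = EFin \o (fun n => dyadic_mean n g x)).
  by move/fine_cvgP => [].
apply/funext => n /=; have [k xk] := bin_cover (expn_gt0 2 n) x01.
rewrite (dyadic_meanE _ xk) lebesgue_measure_dyadic_cell (dyadic_cell_bin xk).
rewrite inver gt_eqF ?invr_gt0 ?exprn_gt0// invrK EFinM; congr (_ * _)%E.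
have mb := @measurable_bin R (2 ^ n) k.
rewrite /binint /Rintegral fineK; last first.
  apply: integrable_fin_num => //; first exact: measurableI.
  by apply: integrableS ig => //; exact: measurableI.
rewrite setIC integral_mkcondr; apply: eq_integral => y _.
by rewrite !patchE; case: ifPn.
Qed.

(** The dyadic means of [g] converge to [g] almost everywhere by Lebesgue
differentiation, so Fatou's lemma bounds the norm of [g] by the limit of the norms
of its projections. *)
Lemma integral_sqr_le_proj_energy (g : R -> R) (M : R) (N : nat) :
  mu.-integrable `[0, 1] (EFin \o g) ->
  (forall n, (N <= n)%N -> proj_energy n g <= M) ->
  (\int[mu]_(x in `[0%R, 1%R]) (g x ^+ 2)%:E <= M%:E)%E.
Proof.
move=> ig HM; have mg : measurable_fun (`[0, 1]%classic : set R) g.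
  by apply/measurable_EFinP; case/integrableP: ig.
have [A [mA A0 HA]] := cvg_dyadic_mean ig.
have mg01 : measurable_fun (`[0, 1[%classic : set R) (fun x => (g x ^+ 2)%:E).
  apply/measurable_EFinP/measurable_funX.
  by apply: measurable_funS mg => // x /=; rewrite !in_itv/= => /andP[-> /ltW].
rewrite -integral_itv_bndo_bndc//.
(* on D the convergence holds everywhere, and 1 belongs to no bin *)
pose D : set R := `[0%R, 1%R[ `\` A.
have mD : measurable D by exact: measurableD.
rewrite (ge0_negligible_integral mA)//; last by move=> x _; rewrite lee_fin sqr_ge0.
have mdm n : measurable_fun setT (fun x => (dyadic_mean n g x ^+ 2)%:E).
  by apply/measurable_EFinP/measurable_funX; exact: measurable_dyadic_mean.
apply: (@le_trans _ _ (limn_einf (fun n =>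
    \int[mu]_(x in D) (dyadic_mean n g x ^+ 2)%:E)%E)).
  have mF n : measurable_fun D (fun x => (dyadic_mean n g x ^+ 2)%:E).
    exact: measurable_funTS.
  have F0 n x : D x -> (0 <= (dyadic_mean n g x ^+ 2)%:E)%E.
    by move=> _; rewrite lee_fin sqr_ge0.
  apply: le_trans (fatou mu mD mF F0).
  rewrite le_eqVlt; apply/orP; left; apply/eqP/eq_integral => x.
  rewrite inE => -[/=]; rewrite in_itv/= => x01 nA.
  have cx : dyadic_mean n g x @[n --> \oo] --> g x.
    by apply: contrapT => ncx; apply: nA; apply: HA => /(_ x01).
  have cx2 : (dyadic_mean n g x ^+ 2)%:E @[n --> \oo] --> (g x ^+ 2)%:E.
    apply: cvg_EFin; first exact: nearW.
    by rewrite expr2; under eq_fun do rewrite expr2; exact: cvgM.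
  by rewrite (cvg_limn_einf_sup cx2).1.
rewrite limn_einf_lim.
apply: lime_le; first exact: is_cvg_einfs.
near=> n.
apply: (@le_trans _ _ (\int[mu]_(x in D) (dyadic_mean n g x ^+ 2)%:E)%E).
  by apply: ereal_inf_lbound; exists n => //=.
apply: (@le_trans _ _ (\int[mu]_(x in `[0%R, 1%R[) (dyadic_mean n g x ^+ 2)%:E)%E).
  apply: ge0_subset_integral => //.
  - by apply: measurable_funTS; exact: mdm.
  - by move=> x _; rewrite lee_fin sqr_ge0.
  - by move=> x [].
apply: (@le_trans _ _ (proj_energy n g)%:E).
  by rewrite le_eqVlt; apply/orP; left; apply/eqP; exact: integral_dyadic_mean_sqr.
by rewrite lee_fin; apply: HM; near: n; exact: nbhs_infty_ge.
Unshelve. all: by end_near. Qed.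

End dyadic.

(** * The Haar coefficients control the bias *)

Section haar.
Context {R : realType}.
Local Notation mu := (@lebesgue_measure R).
Implicit Types g : R -> R.

Lemma sum_ord_double N (F : nat -> R) :
  \sum_(k < 2 * N) F k = \sum_(k < N) (F (2 * k)%N + F (2 * k).+1).
Proof.
elim: N => [|N ih]; first by rewrite muln0 !big_ord0.
by rewrite mulnS big_ord_recr/= big_ord_recr/= ih [RHS]big_ord_recr/= addrA.
Qed.

Lemma bin_double L k :
  bin L k = bin (2 * L) (2 * k) `|` bin (2 * L) (2 * k).+1 :> set R.
Proof.
apply/seteqP; split=> x; rewrite /bin/= -!natr1 !natrM.
  move=> /andP[h1 h2]; have [h|h] := ltP (2%:R * L%:R * x - 2%:R * k%:R) 1.
    by left; apply/andP; split; lra.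
  by right; apply/andP; split; lra.
by case=> /andP[h1 h2]; apply/andP; split; lra.
Qed.

Lemma integrable_bin g L k : mu.-integrable `[0, 1] (EFin \o g) ->
  mu.-integrable (`[0, 1] `&` bin L k) (EFin \o g).
Proof.
have mb := @measurable_bin R L k.
by move=> ig; apply: integrableS ig => //; exact: measurableI.
Qed.

Lemma binint_double g L k : mu.-integrable `[0, 1] (EFin \o g) ->
  binint L k g = binint (2 * L) (2 * k) g + binint (2 * L) (2 * k).+1 g.
Proof.
have mb l := @measurable_bin R (2 * L) l.
move=> ig; rewrite /binint bin_double setIUr Rintegral_setU//.
- exact: measurableI.
- exact: measurableI.
- by rewrite -setIUr -bin_double; exact: integrable_bin.
- apply/disj_setPS => x [[_ h1] [_ h2]].
  by have /eqP := bin_inj h1 h2; rewrite ltn_eqF.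
Qed.

Lemma psiE L k (x : R) : psi (L%:R * x - k%:R) =
  \1_(bin (2 * L) (2 * k)) x - \1_(bin (2 * L) (2 * k).+1) x.
Proof.
rewrite /psi !indicE; congr ((nat_of_bool _)%:R - (nat_of_bool _)%:R);
  apply/idP/idP; rewrite !inE/= in_itv/= /bin/= -?[(2 * k).+1%:R]natr1 !natrM;
  move=> /andP[h1 h2]; apply/andP; split; lra.
Qed.

Lemma haar_coefE j k g : mu.-integrable `[0, 1] (EFin \o g) ->
  haar_coef j k g = 2 `^ (j%:R / 2) *
    (binint (2 * 2 ^ j) (2 * k) g - binint (2 * 2 ^ j) (2 * k).+1 g).
Proof.
move=> ig.
have mb l := @measurable_bin R (2 * 2 ^ j) l.
have E l : binint (2 * 2 ^ j) l g =
    \int[mu]_(x in `[0%R, 1%R]) (g x * \1_(bin (2 * 2 ^ j) l) x).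
  rewrite /binint Rintegral_mkcondr; apply: eq_Rintegral => x _.
  by rewrite patchE indicE; case: ifPn => _; rewrite ?mulr1 ?mulr0.
have I l : mu.-integrable `[0, 1] (EFin \o (fun x => g x * \1_(bin (2 * 2 ^ j) l) x)).
  rewrite (_ : EFin \o _ = (EFin \o g) \_ (bin (2 * 2 ^ j) l)).
    by apply/integrable_restrict => //; exact: integrable_bin.
  apply/funext => x /=; rewrite patchE indicE.
  by case: ifPn => _; rewrite ?mulr1 ?mulr0.
rewrite !E -RintegralB// -RintegralZl//; last first.
  pose G l x := g x * \1_(bin (2 * 2 ^ j) l) x.
  rewrite (_ : EFin \o _ = (EFin \o G (2 * k)%N) \- (EFin \o G (2 * k).+1))%E//.
  by apply: integrableB => //; exact: I.
rewrite /haar_coef; apply: eq_Rintegral => x _.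
by rewrite -natrX psiE -mulrA mulrBr.
Qed.

(** Parallelogram identity on each bin [a + b] with halves [a] and [b]:
[2 * (a ^ 2 + b ^ 2) = (a + b) ^ 2 + (a - b) ^ 2], where [a - b] is the Haar
coefficient up to its normalisation. *)
Lemma proj_energyS j g : mu.-integrable `[0, 1] (EFin \o g) ->
  proj_energy j.+1 g = proj_energy j g + \sum_(k < 2 ^ j) haar_coef j k g ^+ 2.
Proof.
move=> ig; rewrite /proj_energy expnS.
rewrite (sum_ord_double _ (fun k => binint (2 * 2 ^ j) k g ^+ 2)).
rewrite !mulr_sumr -big_split/=; apply: eq_bigr => k _.
rewrite (@binint_double g (2 ^ j) k ig) (haar_coefE _ _ ig) exprMn.
have -> : (2 `^ (j%:R / 2)) ^+ 2 = 2 ^+ j :> R.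
  by rewrite -powR_mulrn ?powR_ge0// -powRrM divfK ?pnatr_eq0// powR_mulrn.
by rewrite exprS; ring.
Qed.

Lemma powR2N_lt1 (s : R) : 0 < s -> 2 `^ (- (2 * s)) < 1 :> R.
Proof.
move=> s0; have : (1 : R) `^ (2 * s) < 2 `^ (2 * s).
  by rewrite gt0_ltr_powR ?mulr_gt0// ?nnegrE// ltr1n.
by rewrite powR1 powRN invf_lt1 ?powR_gt0.
Qed.

(** The energies of the levels [J, ..., n - 1] add up to a part of a geometric
series. *)
Lemma proj_energy_le (s r : R) g J n : mu.-integrable `[0, 1] (EFin \o g) ->
  0 < s -> besov0 s r g -> (J <= n)%N ->
  proj_energy n g <= proj_energy J g +
    r ^+ 2 * 2 `^ (- (2 * J%:R * s)) / (1 - 2 `^ (- (2 * s))).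
Proof.
move=> ig s0 [_ Hg] Jn; set x := 2 `^ (- (2 * s)).
have x0 : 0 < x by exact: powR_gt0.
have x1 : x < 1 by exact: powR2N_lt1.
have E j : 2 `^ (- (2 * j%:R * s)) = x ^+ j.
  by rewrite /x -powR_mulrn ?powR_ge0// -powRrM; congr (_ `^ _); ring.
have H j : \sum_(k < 2 ^ j) haar_coef j k g ^+ 2 <= r ^+ 2 * x ^+ j.
  by rewrite -E.
rewrite E -(subnKC Jn); move: (n - J)%N => {Jn}m.
have x1' : 0 < 1 - x by rewrite subr_gt0.
suff : proj_energy (J + m) g <= proj_energy J g +
    r ^+ 2 * (x ^+ J - x ^+ (J + m)) / (1 - x).
  move=> h; apply: le_trans h _; rewrite lerD2l ler_pM2r ?invr_gt0//.
  by rewrite ler_wpM2l ?sqr_ge0// gerBl exprn_ge0// ltW.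
elim: m => [|m ih]; first by rewrite addn0 subrr mulr0 mul0r addr0.
rewrite addnS proj_energyS//; apply: le_trans (lerD ih (H _)) _.
rewrite -addrA lerD2l le_eqVlt; apply/orP; left; apply/eqP.
by rewrite [x ^+ (J + m).+1]exprS; field; rewrite gt_eqF.
Qed.

End haar.

(** * Norms and projections *)

Section norms.
Context {R : realType}.
Local Notation mu := (@lebesgue_measure R).
Implicit Types (f g : density R).

Lemma norm2E (g : R -> R) :
  norm2 g = ((\int[mu]_(x in `[0%R, 1%R]) (g x ^+ 2)%:E) `^ 2^-1)%E.
Proof.
rewrite /norm2 unlock /Lnorm; congr (_ `^ _)%E.
rewrite [RHS]integral_mkcond; apply: eq_integral => x _.
rewrite /= powR_mulrn// real_normK ?num_real// !patchE.
by case: ifPn => // _; rewrite expr0n.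
Qed.

Lemma norm2_le (g : R -> R) (M : R) :
  (\int[mu]_(x in `[0%R, 1%R]) (g x ^+ 2)%:E <= M%:E)%E ->
  (norm2 g <= (Num.sqrt M)%:E)%E.
Proof.
move=> h; have i0 : (0 <= \int[mu]_(x in `[0%R, 1%R]) (g x ^+ 2)%:E)%E.
  by apply: integral_ge0 => x _; rewrite lee_fin sqr_ge0.
have M0 : 0 <= M by rewrite -lee_fin (le_trans i0).
rewrite norm2E -(powR12_sqrt M0) -poweR_EFin.
by apply: gt0_ler_poweR; rewrite ?in_itv/= ?leey ?andbT// ?invr_ge0.
Qed.

Lemma L2_integrable_sqr (g : R -> R) : L2 g ->
  mu.-integrable `[0, 1] (fun x => (g x ^+ 2)%:E).
Proof.
move=> /Lfun2P[_ ig]; apply/integrable_mkcond => //.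
rewrite (_ : _ \_ _ = fun x => (((g \_ `[0, 1]) x) ^+ 2)%:E)//.
by apply/funext => x; rewrite !patchE; case: ifPn; rewrite ?expr0n.
Qed.

Lemma fine_norm2 (g : R -> R) : L2 g ->
  fine (norm2 g) = Num.sqrt (\int[mu]_(x in `[0%R, 1%R]) (g x ^+ 2)).
Proof.
move=> L2g; rewrite norm2E.
have fi : (\int[mu]_(x in `[0%R, 1%R]) (g x ^+ 2)%:E)%E \is a fin_num.
  by apply: integrable_fin_num => //; exact: L2_integrable_sqr.
rewrite -(fineK fi) poweR_EFin/= powR12_sqrt//.
by apply: fine_ge0; apply: integral_ge0 => x _; rewrite lee_fin sqr_ge0.
Qed.

(** Bessel's inequality for the orthonormal functions [phi L k]: integrate
[2 * c * f - c ^ 2 <= f ^ 2] on each bin, where [c] is the mean value of [f] on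
the bin. *)
Lemma mean_norm_le f L : L2 f -> mean_norm f L <= fine (norm2 f).
Proof.
move=> L2f; rewrite fine_norm2// /mean_norm ler_sqrt; last first.
  by apply: Rintegral_ge0 => x _; exact: sqr_ge0.
pose c (k : 'I_L) := L%:R * mass f L k.
pose G (k : 'I_L) x := (2 * c k * f x - c k ^+ 2) * \1_(bin L k) x.
have mb k := @measurable_bin R L k.
have m01 : measurable (`[0, 1]%classic : set R) by [].
have if' := integrable_density f.
have iff := L2_integrable_sqr L2f.
have ib (k : 'I_L) : mu.-integrable (`[0, 1] `&` bin L k)
    (EFin \o (fun x => 2 * c k * f x)).
  rewrite (_ : _ \o _ = fun x => (2 * c k)%:E * (EFin \o f) x)%E//.
  by apply: integrableZl; [exact: measurableI|exact: integrable_bin].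
have ic (k : 'I_L) : mu.-integrable (`[0, 1] `&` bin L k)
    (EFin \o (fun _ : R => c k ^+ 2)).
  have i01 : mu.-integrable (`[0, 1]%classic : set R) (EFin \o (fun _ : R => c k ^+ 2)).
    apply: continuous_compact_integrable; first exact: segment_compact.
    by apply: continuous_subspaceT => x; exact: cvg_cst.
  by apply: integrableS i01 => //; exact: measurableI.
have iG k : mu.-integrable `[0, 1] (EFin \o G k).
  rewrite (_ : EFin \o _ = (EFin \o (fun x => 2 * c k * f x - c k ^+ 2)) \_ (bin L k)).
    apply/integrable_restrict => //.
    pose F1 x := 2 * c k * f x; pose F2 (_ : R) := c k ^+ 2.
    rewrite (_ : _ \o _ = (EFin \o F1) \- (EFin \o F2))%E//.
    by apply: integrableB => //; exact: measurableI.
  apply/funext => x /=; rewrite patchE /G indicE.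
  by case: ifPn => _; rewrite ?mulr1 ?mulr0.
have EG k : \int[mu]_(x in `[0%R, 1%R]) G k x = alpha0 f L k ^+ 2.
  rewrite (_ : \int[mu]_(x in _) _ = \int[mu]_(x in `[0%R, 1%R] `&` bin L k)
    (2 * c k * f x - c k ^+ 2)); last first.
    rewrite Rintegral_mkcondr; apply: eq_Rintegral => x _.
    by rewrite patchE /G indicE; case: ifPn => _; rewrite ?mulr1 ?mulr0.
  have mI : measurable (`[0, 1] `&` bin L k : set (measurableTypeR R)).
    by apply: measurableI => //; exact: mb.
  rewrite (RintegralB mI (ib k) (ic k)).
  rewrite (RintegralZl _ mI (integrable_bin L k if')).
  rewrite Rintegral_cst// -/(binint L k f) -massE.
  rewrite setIidr; last first.
    by move=> x /(bin_sub01 (ltn_ord k))/=; rewrite !in_itv/= => /andP[-> /ltW].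
  have L0 : (0 < L)%N by exact: leq_ltn_trans (ltn_ord k).
  rewrite [X in _ - _ * fine X](_ : _ = (L%:R^-1)%:E); last exact: lebesgue_measure_bin.
  rewrite /= /c alpha0E !exprMn sqr_sqrtr//; field.
  by rewrite pnatr_eq0 -lt0n.
rewrite -(eq_bigr _ (fun k _ => EG k)) -Rintegral_sum//.
apply: le_Rintegral => //; first exact: integrable_sumR.
move=> x _; have [[k xk]|nx] := pselect (exists k : 'I_L, bin L k x).
  rewrite /G (sum_indic_bin (fun k => 2 * c k * f x - c k ^+ 2) xk) -subr_ge0.
  by rewrite (_ : _ - _ = (f x - c k) ^+ 2) ?sqr_ge0//; ring.
by rewrite /G (sum_indic_bin_out (fun k => 2 * c k * f x - c k ^+ 2) nx) sqr_ge0.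
Qed.

Lemma energy_proj f g J : energy f g (2 ^ J) = proj_energy J (f \- g).
Proof.
rewrite /energy /proj_energy mulr_sumr; apply: eq_bigr => k _.
rewrite /signal !alpha0E -mulrBr exprMn sqr_sqrtr// natrX !massE.
congr (_ * _ ^+ 2); rewrite /binint -RintegralB//.
- by apply: measurableI => //; exact: measurable_bin.
- exact/integrable_bin/integrable_density.
- exact/integrable_bin/integrable_density.
Qed.

(** The squared distance is at most what the projection sees plus the bias that
the Besov ball allows. *)
Lemma besov_norm2_le f g (s r : R) J : 0 < s -> besov g s r f ->
  (norm2 (f \- g)%R <= (Num.sqrt (energy f g (2 ^ J) +
     r ^+ 2 * 2 `^ (- (2 * J%:R * s)) / (1 - 2 `^ (- (2 * s)))))%:E)%E.
Proof.
move=> s0 [_ Bfg]; apply: norm2_le.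
have ifg : mu.-integrable `[0, 1] (EFin \o (f \- g)%R).
  rewrite (_ : EFin \o _ = (EFin \o f) \- (EFin \o g))%E//.
  by apply: integrableB => //; exact: integrable_density.
apply: (integral_sqr_le_proj_energy (N := J) ifg) => n Jn.
by rewrite energy_proj; exact: (proj_energy_le ifg s0 Bfg Jn).
Qed.

End norms.

(** * Chebyshev's inequality and the separation condition *)

Section chebyshev.
Context d (T : measurableType d) (R : realType) (P : probability T R).
Implicit Types (S : T -> R) (t V gamma : R).

Lemma Lfun2_chebyshev S t (A : set T) : S \in Lfun P 2%:E -> measurable A ->
  (forall x, A x -> t ^+ 2 <= S x ^+ 2) ->
  t ^+ 2 * fine (P A) <= \int[P]_x (S x ^+ 2).
Proof.
move=> L2S mA tS.
have iA : P.-integrable setT (EFin \o (\1_A : T -> R)).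
  apply: integrable_indic => //; rewrite -ge0_fin_numE//; exact: fin_num_measure.
have -> : fine (P A) = \int[P]_x \1_A x by rewrite /Rintegral integral_indic ?setIT.
rewrite -RintegralZl//; apply: le_Rintegral => //.
- exact: integrable_scaleR.
- exact: Lfun2_integrable_sqr.
- move=> x _; rewrite indicE; case: (boolP (x \in A)) => [/set_mem/tS|_].
    by rewrite mulr1.
  by rewrite mulr0 sqr_ge0.
Qed.

(** Chebyshev on the right tail puts [t] in the set whose infimum is the
quantile. *)
Lemma quantile_le S t V gamma : S \in Lfun P 2%:E -> \int[P]_x (S x ^+ 2) <= V ->
  0 < gamma < 1 -> 0 < t -> V <= gamma * t ^+ 2 -> quantile P S (1 - gamma) <= t.
Proof.
move=> L2S SV /andP[g0 g1] t0 Vt; have /Lfun2P[mS _] := L2S.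
have mle u : measurable [set x | S x <= u].
  rewrite -[X in measurable X]setTI.
  rewrite (_ : [set x | _] = S @^-1` `]-oo, u]); first exact: mS.
  by apply/seteqP; split=> x /=; rewrite in_itv.
have V0 : 0 <= V by apply: le_trans SV; apply: Rintegral_ge0 => x _; exact: sqr_ge0.
apply: ge_inf; last first.
  have := @Lfun2_chebyshev S t (~` [set x | S x <= t]) L2S (measurableC (mle t)).
  rewrite probability_setC// => H.
  have /H : forall x, (~` [set x | S x <= t]) x -> t ^+ 2 <= S x ^+ 2.
    move=> x /= /negP; rewrite -ltNge => tS.
    by rewrite ler_sqr ?nnegrE; lra.
  have fin := fin_num_measure P _ (mle t).
  rewrite -(fineK fin) -EFinB => h.
  rewrite /= -(fineK fin) lee_fin.
  have t20 : 0 < t ^+ 2 by exact: exprn_gt0.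
  have h' : t ^+ 2 * (1 - fine (P [set x | S x <= t])) <= V by exact: le_trans SV.
  by rewrite lerBlDr -lerBlDl -(ler_pM2l t20); lra.
(* the infimum is genuine: by Chebyshev on the left tail, - B is a lower bound *)
pose B := Num.sqrt ((V + 1) / (1 - gamma)).
have g1' : 0 < 1 - gamma by lra.
have B2 : B ^+ 2 * (1 - gamma) = V + 1.
  by rewrite sqr_sqrtr ?divfK ?gt_eqF// divr_ge0//; lra.
exists (- B) => u /= hu; rewrite leNgt; apply/negP => uB.
have B0 : 0 <= B by exact: sqrtr_ge0.
have h : B ^+ 2 * fine (P [set x | S x <= u]) <= \int[P]_x (S x ^+ 2).
  apply: Lfun2_chebyshev => // x /= Su.
  by rewrite -[S x ^+ 2]sqrrN ler_sqr ?nnegrE; lra.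
have fin := fin_num_measure P _ (mle u).
have {}hu : 1 - gamma <= fine (P [set x | S x <= u]).
  by rewrite -lee_fin (fineK fin).
have : B ^+ 2 * (1 - gamma) <= B ^+ 2 * fine (P [set x | S x <= u]).
  by rewrite ler_wpM2l ?sqr_ge0.
lra.
Qed.

End chebyshev.

Section numerics.
Context {R : realType}.

(** [8 * q * M0 / gamma] bounds the quantile under the null hypothesis. The
constant makes it at most [a / 2] and [q * M] at most [beta * a / 64]; then the
mean squared error is at most [beta * (a / 2) ^ 2]. The term [q * sqrt a] of
[q * M] is where [r <= 1] matters: [r ^ 2 * sqrt a <= r * sqrt a], and
[r] is at most [sqrt a] divided by the constant. *)
Lemma separation_numerics (beta gamma M0 M q r a : R) :
  0 < beta < 1 -> 0 < gamma < 1 -> 1 <= M0 -> 0 <= q -> 0 < r <= 1 ->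
  q <= 5 * r ^+ 2 -> 0 <= M <= M0 + 2 * Num.sqrt a ->
  (640 * (M0 + 1) / (beta * gamma)) ^+ 2 * r ^+ 2 < a ->
  8 * q * M0 / gamma < a /\
  8 * a * q * M + 64 * q ^+ 2 * M ^+ 2 <= beta * (a - 8 * q * M0 / gamma) ^+ 2.
Proof.
move=> /andP[b0 b1] /andP[g0 g1] M1.
have p640 : 0 < 640 * (M0 + 1) by lra.
move=> q0 /andP[r0 r1] qr /andP[HM0 HM].
set k := 640 * (M0 + 1) / (beta * gamma) => ka.
have bg0 : 0 < beta * gamma by exact: mulr_gt0.
have kbg : k * beta * gamma = 640 * (M0 + 1).
  by rewrite -mulrA divfK// gt_eqF.
have k0 : 0 < k by exact: divr_gt0 p640 bg0.
have kb : 640 * (M0 + 1) <= k * beta by rewrite -kbg; nra.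
have kg : 640 * (M0 + 1) <= k * gamma by rewrite -kbg; nra.
have k1 : 1 <= k by nra.
have a0 : 0 < a by apply: le_lt_trans ka; rewrite mulr_ge0// sqr_ge0.
pose x := Num.sqrt a; have x2 : x ^+ 2 = a by rewrite sqr_sqrtr// ltW.
have x0 : 0 < x by rewrite sqrtr_gt0.
have krx : k * r < x.
  have kr0 : 0 <= k * r by exact: mulr_ge0 (ltW k0) (ltW r0).
  by rewrite -(ltr_sqr kr0 (ltW x0)) x2 exprMn.
have qM : k * (q * M) <= 10 * (M0 + 1) * a.
  have h1 : q * M <= 5 * r ^+ 2 * (M0 + 2 * x) by exact: ler_pM.
  have h2 : r ^+ 2 <= r by rewrite expr2; nra.
  have h3 : k * r ^+ 2 * M0 <= a * M0.
    rewrite ler_wpM2r ?(le_trans _ M1)//; apply: le_trans (ltW ka).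
    by rewrite ler_wpM2r ?sqr_ge0//; nra.
  have h4 : k * r ^+ 2 * x <= a.
    rewrite -x2 [x ^+ 2]expr2 ler_wpM2r ?(ltW x0)//; nra.
  have h5 : k * (q * M) <= k * (5 * r ^+ 2 * (M0 + 2 * x)) by rewrite ler_wpM2l// ltW.
  nra.
have qe : q * M <= beta * a / 64.
  have : 640 * (M0 + 1) * (q * M) <= beta * (10 * (M0 + 1) * a).
    apply: (@le_trans _ _ (k * beta * (q * M))).
      by rewrite ler_wpM2r// mulr_ge0.
    by rewrite mulrAC mulrC ler_wpM2l// ltW.
  have : 0 < M0 + 1 by lra.
  nra.
have tle : 8 * q * M0 / gamma <= a / 2.
  rewrite ler_pdivrMr//.
  have : 8 * q * M0 <= 40 * r ^+ 2 * M0 by nra.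
  have : k ^+ 2 * r ^+ 2 * gamma <= a * gamma by rewrite ler_wpM2r ?ltW.
  have : 640 * (M0 + 1) * r ^+ 2 <= k ^+ 2 * r ^+ 2 * gamma.
    by rewrite [leRHS]mulrAC ler_wpM2r ?sqr_ge0// expr2; nra.
  have := sqr_ge0 r; nra.
set t := 8 * q * M0 / gamma in tle *.
have qM0 : 0 <= q * M by exact: mulr_ge0.
split; first by lra.
have h1 : 8 * a * q * M <= beta * a ^+ 2 / 8 by nra.
have h2 : 64 * q ^+ 2 * M ^+ 2 <= beta * a ^+ 2 / 64.
  have : (q * M) ^+ 2 <= (beta * a / 64) ^+ 2 by rewrite ler_sqr ?nnegrE; lra.
  rewrite !exprMn exprVn; have := sqr_ge0 a; nra.
have h3 : (a / 2) ^+ 2 <= (a - t) ^+ 2 by rewrite ler_sqr ?nnegrE; lra.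
nra.
Qed.

End numerics.

(** * The rate *)

Section rates.
Context {R : realType}.

Lemma smallest_exponent_lt (x : R) J : smallest_exponent x J -> 2 ^+ J < 2 * x.
Proof.
move=> [_ H]; rewrite ltNge; apply/negP => h.
have /H : x <= 2 ^ (J%:Z - 1).
  rewrite expfzDr// exprN1 -[2 ^ J%:Z]/(2 ^+ J).
  by rewrite ler_pdivlMr// mulrC.
by rewrite lerBrDr gerDl.
Qed.

(** With [u = A ^ (1 / (4 s + c))] and [U = u ^ (2 s)] every power of [A] that
occurs in the rate is a monomial in [u] and [U]. *)
Lemma rate_split (A s c : R) : 1 <= A -> 0 < s -> 0 < c ->
  exists u U : R, [/\ 1 <= u, 1 <= U & U = u `^ (2 * s)] /\
    [/\ A = U ^+ 2 * u `^ c, A `^ (2 / (4 * s + c)) = u ^+ 2 &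
    A `^ (- (2 * s / (4 * s + c))) = U^-1].
Proof.
move=> A1 s0 c0; have A0 : 0 < A by lra.
pose e := 4 * s + c; have e0 : 0 < e by rewrite /e; lra.
have eN0 : e != 0 by rewrite gt_eqF.
pose u := A `^ e^-1.
have u1 : 1 <= u by rewrite -(powRr0 A) ler_powR// invr_ge0 ltW.
have uA x : u `^ x = A `^ (x / e) by rewrite /u -powRrM mulrC.
have u0 : 0 < u by lra.
exists u, (u `^ (2 * s)); split; split => //.
- by rewrite -[leLHS](powRr0 u) ler_powR// mulr_ge0// ltW.
- rewrite -powR_mulrn ?powR_ge0// -powRrM -powRD; last by rewrite (gt_eqF u0) implybT.
  have -> : 2 * s * 2%:R + c = e by rewrite /e; ring.
  by rewrite uA divff// powRr1// ltW.
- by rewrite -powR_mulrn ?(ltW u0)// uA.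
- by rewrite uA powRN.
Qed.

(** Let [u] and [U] be the quantities of [rate_split] for [n * alpha ^ 2], and [w]
and [W] those for [n]. Then [2 ^ J] is within a factor two of the smaller of
[u ^ 2] and [w ^ 2]. As it is
at least one of them, the bias is at most the square of the rate; as it is less
than twice both, each of the two terms of the noise rate is at most a multiple of
[U^-2] or [W^-2]. *)
Lemma rate_bounds (n J : nat) (s alpha : R) (r : R) :
  (2 <= n)%N -> 0 < s -> (Num.sqrt n%:R)^-1 <= alpha ->
  smallest_exponent (Num.min ((n%:R * alpha ^+ 2) `^ (2 / (4 * s + 3)))
                             (n%:R `^ (2 / (4 * s + 1)))) J ->
  r = Num.max ((n%:R * alpha ^+ 2) `^ (- (2 * s / (4 * s + 3))))
              (n%:R `^ (- (2 * s / (4 * s + 1)))) ->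
  [/\ 0 < r <= 1, noise_rate alpha (2 ^ J) n <= 5 * r ^+ 2 &
      2 `^ (- (2 * J%:R * s)) <= r ^+ 2].
Proof.
move=> n2 s0 na xJ rE; have J2 := smallest_exponent_lt xJ; have [xle _] := xJ.
have n0 : 0 < n%:R :> R by rewrite ltr0n (ltn_trans _ n2).
have n1 : 1 <= n%:R :> R by rewrite ler1n (ltn_trans _ n2).
set A := n%:R * alpha ^+ 2 in xJ xle J2 rE.
have sn0 : 0 < Num.sqrt n%:R :> R by rewrite sqrtr_gt0.
have alpha0 : 0 < alpha by apply: lt_le_trans na; rewrite invr_gt0.
have A1 : 1 <= A.
  have : 1 <= alpha * Num.sqrt n%:R by rewrite -ler_pdivrMr// mul1r.
  move=> h; rewrite /A -(sqr_sqrtr (ltW n0)) mulrC -exprMn.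
  by rewrite expr_ge1// ltW// mulr_gt0.
have [u [U [[u1 U1 UE] [AE xA rA]]]] := rate_split A1 s0 (ltr0Sn R 2).
have [w [W [[w1 W1 WE] [nE xn rn]]]] := rate_split n1 s0 (@ltr01 R).
rewrite xA xn in xle J2; rewrite rA rn in rE.
have u0 : 0 < u by lra.
have w0 : 0 < w by lra.
have U0 : 0 < U by lra.
have W0 : 0 < W by lra.
rewrite powRr1 ?(ltW w0)// in nE.
rewrite powR_mulrn ?(ltW u0)// in AE.
have rU : U^-1 <= r by rewrite rE le_max lexx.
have rW : W^-1 <= r by rewrite rE le_max lexx orbT.
have r0 : 0 < r by apply: lt_le_trans rU; rewrite invr_gt0.
have r1 : r <= 1 by rewrite rE ge_max !invf_le1// U1 W1.
have rU2 : (U ^+ 2)^-1 <= r ^+ 2.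
  by rewrite -exprVn ler_sqr ?nnegrE ?invr_ge0 ?(ltW U0) ?(ltW r0).
have rW2 : (W ^+ 2)^-1 <= r ^+ 2.
  by rewrite -exprVn ler_sqr ?nnegrE ?invr_ge0 ?(ltW W0) ?(ltW r0).
split; first by rewrite r0.
  rewrite /noise_rate natrX; set l := Num.sqrt (2 ^+ J).
  have l2 : l ^+ 2 = 2 ^+ J by rewrite sqr_sqrtr// exprn_ge0.
  have l0 : 0 <= l by exact: sqrtr_ge0.
  have lu2 : l ^+ 2 <= 2 * u ^+ 2.
    by rewrite l2; apply: le_trans (ltW J2) _; rewrite ler_wpM2l// ge_min lexx.
  have lw2 : l ^+ 2 <= 2 * w ^+ 2.
    by rewrite l2; apply: le_trans (ltW J2) _; rewrite ler_wpM2l// ge_min lexx orbT.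
  (* 3 / 2 is a rational upper bound of sqrt 2 *)
  have lu : l <= 3 / 2 * u.
    by rewrite -ler_sqr ?nnegrE//; [rewrite exprMn; nra|lra].
  have lw : l <= 3 / 2 * w.
    by rewrite -ler_sqr ?nnegrE//; [rewrite exprMn; nra|lra].
  have h1 : l / n%:R <= 3 / 2 * (W ^+ 2)^-1.
    rewrite ler_pdivrMr// nE mulrA mulrAC -mulrA.
    rewrite (_ : _ / W ^+ 2 * _ = 3 / 2 * w)//; field.
    by rewrite gt_eqF.
  have h2 : 2 ^+ J * l / A <= 3 * (U ^+ 2)^-1.
    rewrite ler_pdivrMr ?(lt_le_trans _ A1)// AE.
    rewrite (_ : 3 / U ^+ 2 * _ = 3 * u ^+ 3); last by field; rewrite gt_eqF.
    rewrite -l2; apply: (@le_trans _ _ (2 * u ^+ 2 * (3 / 2 * u))).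
      by rewrite ler_pM// sqr_ge0.
    by rewrite le_eqVlt; apply/orP; left; apply/eqP; field.
  apply: le_trans (lerD h1 h2) _.
  have : 0 <= r ^+ 2 by exact: sqr_ge0.
  lra.
have -> : 2 `^ (- (2 * J%:R * s)) = (((2 ^+ J) `^ s) ^+ 2)^-1 :> R.
  rewrite -powR_mulrn ?powR_ge0// -powRrM -powR_mulrn// -powRrM -powRN.
  by congr (_ `^ _); ring.
have key (y : R) : 0 < y -> y ^+ 2 <= 2 ^+ J -> (y `^ (2 * s))^-1 <= r ->
    (((2 ^+ J) `^ s) ^+ 2)^-1 <= r ^+ 2.
  move=> y0 yJ yr; rewrite -exprVn ler_sqr ?nnegrE ?invr_ge0 ?powR_ge0 ?(ltW r0)//.
  apply: le_trans yr; rewrite lef_pV2 ?posrE ?powR_gt0 ?exprn_gt0//.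
  rewrite powRrM powR_mulrn ?(ltW y0)//.
  by rewrite ge0_ler_powR ?nnegrE ?(ltW s0) ?exprn_ge0// ltW.
have [h|h] : u ^+ 2 <= 2 ^+ J \/ w ^+ 2 <= 2 ^+ J.
  by move: xle; rewrite ge_min => /orP[]; [left|right].
- by apply: (key u) => //; rewrite -UE.
- by apply: (key w) => //; rewrite -WE.
Qed.

End rates.

(** * Errors of the test *)

Section test_errors.
Context {R : realType}.
Implicit Types (alpha beta gamma : R) (f g : density R).
Local Notation v := (@laplace_var R).

Lemma energy_ge0 f g L : 0 <= energy f g L.
Proof. by apply: sumr_ge0 => k _; exact: sqr_ge0. Qed.

Lemma energy_self f L : energy f f L = 0.
Proof. by rewrite /energy big1// => k _; rewrite /signal subrr expr0n. Qed.

(** The variance under [f] involves the means under [f]; they are traded for those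
under [g], which depend on the null hypothesis only, and the energy. *)
Lemma mean_norm_triangle f g L :
  mean_norm f L <= 2 * (mean_norm g L + Num.sqrt (energy f g L)).
Proof.
have s0 (h : density R) : 0 <= \sum_(k < L) alpha0 h L k ^+ 2.
  by apply: sumr_ge0 => k _; exact: sqr_ge0.
have e0 := energy_ge0 f g L.
have b0 : 0 <= mean_norm g L by exact: sqrtr_ge0.
have a0 : 0 <= Num.sqrt (energy f g L) by exact: sqrtr_ge0.
have r0 : 0 <= 2 * (mean_norm g L + Num.sqrt (energy f g L)).
  by rewrite mulr_ge0// addr_ge0.
have l0 : 0 <= mean_norm f L by exact: sqrtr_ge0.
rewrite -(ler_sqr l0 r0) exprMn.
have := sqr_sqrtr (s0 f); have := sqr_sqrtr (s0 g); have := sqr_sqrtr e0.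
rewrite -/(mean_norm f L) -/(mean_norm g L) => E1 E2 E3.
have : mean_norm f L ^+ 2 <= 2 * mean_norm g L ^+ 2 +
    2 * Num.sqrt (energy f g L) ^+ 2.
  rewrite E1 E2 E3 /energy !mulr_sumr -big_split/=; apply: ler_sum => k _.
  by rewrite /signal; have := sqr_ge0 (alpha0 f L k - 2 * alpha0 g L k); nra.
nra.
Qed.

Lemma noise_rate_gt0 alpha L n : (0 < L)%N -> (0 < n)%N ->
  0 < noise_rate alpha L n.
Proof.
move=> L0 n0; rewrite /noise_rate ltr_pwDl//.
  by rewrite divr_gt0 ?sqrtr_gt0 ?ltr0n.
by rewrite divr_ge0// mulr_ge0// ?sqrtr_ge0// sqr_ge0.
Qed.

Lemma measurable_Tstat f L n : (2 <= n)%N -> (0 < L)%N ->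
  measurable_fun setT (@Tstat R f L n).
Proof.
move=> n2 L0; have [/Lfun2P[mT _] _] := Tstat_mse f f n2 L0 (@ltr01 R).
rewrite (_ : @Tstat R f L n =
    fun z => (Tstat f z - energy f f L) + energy f f L).
  exact: measurable_funD.
by apply/funext => z; rewrite subrK.
Qed.

Lemma measurable_Tstat_le f L n t : (2 <= n)%N -> (0 < L)%N ->
  measurable [set z | @Tstat R f L n z <= t].
Proof.
move=> n2 L0; rewrite -[X in measurable X]setTI.
rewrite (_ : [set z | _] = @Tstat R f L n @^-1` `]-oo, t]).
  exact: measurable_Tstat.
by apply/seteqP; split=> z /=; rewrite in_itv.
Qed.

(** Under the null hypothesis the energy vanishes, so the mean squared error is of
the order of [noise_rate ^ 2]. *)
Lemma quantile_Tstat_le alpha gamma f L n (M0 : R) : (2 <= n)%N -> (0 < L)%N ->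
  0 < alpha -> 0 < gamma < 1 -> 1 <= M0 -> mean_norm f L + 8 * v <= M0 ->
  quantile (views_prob alpha f L n) (@Tstat R f L n) (1 - gamma) <=
  8 * noise_rate alpha L n * M0 / gamma.
Proof.
move=> n2 L0 a0 /[dup] g01 /andP[g0 g1] M1 HM.
set q := noise_rate alpha L n; set t := 8 * q * M0 / gamma.
have q0 : 0 < q by rewrite noise_rate_gt0// (ltn_trans _ n2).
rewrite (_ : quantile _ _ _ =
  quantile (iid_prob (view_prob alpha f L) n) (@Tstat R f L n) (1 - gamma)).
  have [L2T HT] := Tstat_mse f f n2 L0 a0.
  have E : (fun z : n.-tuple (L.-tuple (measurableTypeR R)) =>
      Tstat f z - energy f f L) = @Tstat R f L n.
    by apply/funext => z; rewrite energy_self subr0.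
  rewrite E in L2T.
  have t0 : 0 < t by rewrite divr_gt0// !mulr_gt0//; lra.
  apply: (@quantile_le _ _ _ _ _ _ (64 * q ^+ 2 * M0 ^+ 2)) => //.
    apply: le_trans (_ : _ <= 64 * q ^+ 2 * (mean_norm f L + 8 * v) ^+ 2) _.
      move: HT; rewrite energy_self mulr0 !mul0r add0r.
      by under eq_Rintegral do rewrite subr0.
    have b0 : 0 <= mean_norm f L by exact: sqrtr_ge0.
    have v0 := @laplace_var_ge0 R.
    apply: ler_wpM2l; first by rewrite mulr_ge0// sqr_ge0.
    by rewrite ler_sqr ?nnegrE; lra.
  rewrite /t !exprMn exprVn (_ : gamma * _ = 64 * q ^+ 2 * M0 ^+ 2 / gamma).
    rewrite ler_pdivlMr//; apply: ler_piMr; last exact: ltW.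
    by apply: mulr_ge0; [apply: mulr_ge0 => //|]; exact: sqr_ge0.
  by field; rewrite gt_eqF.
rewrite /quantile; congr inf; apply/funext => u; rewrite /mkset.
by rewrite views_prob_iid//; exact: measurable_Tstat_le.
Qed.

(** When the test accepts, the statistic is below the quantile, hence far below
the energy that it estimates; Chebyshev bounds the probability of this
deviation. *)
Lemma test_type2_le alpha gamma beta f g L n (M0 r : R) :
  (2 <= n)%N -> (0 < L)%N -> 0 < alpha ->
  0 < gamma < 1 -> 0 < beta < 1 ->
  2 * mean_norm g L + 8 * v + 1 <= M0 ->
  0 < r <= 1 -> noise_rate alpha L n <= 5 * r ^+ 2 ->
  (640 * (M0 + 1) / (beta * gamma)) ^+ 2 * r ^+ 2 < energy f g L ->
  (views_prob alpha f L n [set z | @test R alpha gamma g L n z = 0%N] <= beta%:E)%E.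
Proof.
move=> n2 L0 alpha_gt0 g01 b01 HM r01 qr Ha.
have v0 := @laplace_var_ge0 R.
have b0 : 0 <= mean_norm g L by exact: sqrtr_ge0.
have bf0 : 0 <= mean_norm f L by exact: sqrtr_ge0.
have M1 : 1 <= M0 by lra.
set q := noise_rate alpha L n in qr *.
have q0 : 0 < q by rewrite noise_rate_gt0// (ltn_trans _ n2).
have HMf : 0 <= mean_norm f L + 8 * v <= M0 + 2 * Num.sqrt (energy f g L).
  by have := mean_norm_triangle f g L; lra.
have [ta HV] := separation_numerics b01 g01 M1 (ltW q0) r01 qr HMf Ha.
set t := 8 * q * M0 / gamma in ta HV.
have Qt : quantile (views_prob alpha g L n) (@Tstat R g L n) (1 - gamma) <= t.
  by apply: quantile_Tstat_le => //; lra.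
set Q := quantile _ _ _ in Qt.
rewrite (_ : [set z | _] = [set z | Tstat g z <= Q]); last first.
  apply/seteqP; split=> z /=; rewrite /test -/Q leNgt; case: (Q < _) => //.
rewrite views_prob_iid; last exact: measurable_Tstat_le.
set P := iid_prob _ n.
have [L2T HT] := Tstat_mse f g n2 L0 alpha_gt0.
have mQ := measurable_Tstat_le g Q n2 L0.
have at0 : 0 < energy f g L - t by lra.
have H : (energy f g L - t) ^+ 2 * fine (P [set z | Tstat g z <= Q]) <=
    \int[P]_z ((Tstat g z - energy f g L) ^+ 2).
  apply: (Lfun2_chebyshev L2T mQ) => z /= zQ.
  by rewrite -[leRHS]sqrrN ler_sqr ?nnegrE; lra.
have fin : P [set z | Tstat g z <= Q] \is a fin_num by exact: fin_num_measure.
rewrite -(fineK fin) lee_fin -(ler_pM2l (exprn_gt0 2 at0)).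
apply: le_trans H _; apply: le_trans HT _.
by rewrite [leRHS]mulrC.
Qed.

End test_errors.

Theorem theorem4p9 (R : realType) :
  exists C : R -> R -> R -> R -> R -> R,
  forall (f0 : density R), L2 f0 ->
  forall (n : nat) (s r alpha gamma beta : R),
    (2 <= n)%N -> 0 < s -> 0 < r -> (Num.sqrt n%:R)^-1 <= alpha ->
    0 < gamma < 1 -> 0 < beta < 1 -> gamma + beta < 1 ->
  forall J : nat,
    smallest_exponent
      (Num.min ((n%:R * alpha ^+ 2) `^ (2 / (4 * s + 3)))
               (n%:R `^ (2 / (4 * s + 1)))) J ->
  (sep_rate alpha (@test R alpha gamma f0 (2 ^ J)%N n) (besov f0 s r) beta f0
   <= (C s r (fine (norm2 f0)) gamma beta *
       Num.max ((n%:R * alpha ^+ 2) `^ (- (2 * s / (4 * s + 3))))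
               (n%:R `^ (- (2 * s / (4 * s + 1)))))%:E)%E.
Proof.
(* the summand 1 keeps the bound on the quantile positive *)
pose M0 F : R := 2 * F + 8 * laplace_var + 1.
(* the first summand makes the energy large enough for the test, the second one
   covers the bias *)
exists (fun s r F gamma beta => Num.sqrt
  ((640 * (M0 F + 1) / (beta * gamma)) ^+ 2 + r ^+ 2 / (1 - 2 `^ (- (2 * s))))).
move=> f0 L2f0 n s r alpha gamma beta n2 s0 r0 na g01 b01 _ J HJ.
set rate := Num.max _ _.
have [rate01 Hq Hbias] := rate_bounds n2 s0 na HJ erefl.
rewrite -/rate in rate01 Hq Hbias.
have /andP[rate0 rate1] := rate01.
set F := fine (norm2 f0); set K := 640 * (M0 F + 1) / (beta * gamma).
set b := r ^+ 2 / (1 - 2 `^ (- (2 * s))).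
have F0 : 0 <= F by apply: fine_ge0; rewrite /norm2 Lnorm_ge0.
have v0 := @laplace_var_ge0 R.
have /andP[g0 g1] := g01; have /andP[b0 b1] := b01.
have p640 : 0 < 640 * (M0 F + 1) by rewrite /M0; lra.
have K0 : 0 < K by exact: divr_gt0 p640 (mulr_gt0 b0 g0).
have x1 : 2 `^ (- (2 * s)) < 1 :> R by exact: powR2N_lt1.
have bpos : 0 < b by rewrite divr_gt0 ?exprn_gt0// subr_gt0.
have alpha_gt0 : 0 < alpha.
  by apply: lt_le_trans na; rewrite invr_gt0 sqrtr_gt0 ltr0n (ltn_trans _ n2).
have Kb : 0 < K ^+ 2 + b by rewrite addr_gt0// exprn_gt0.
apply: ereal_inf_lbound; exists (Num.sqrt (K ^+ 2 + b) * rate) => //=; split.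
  by rewrite mulr_gt0// sqrtr_gt0.
apply: ge_ereal_sup => _ [f [Bf rho_lt] <-].
have L0 : (0 < 2 ^ J)%N by rewrite expn_gt0.
apply: (@test_type2_le _ alpha gamma beta f f0 (2 ^ J) n (M0 F) rate) => //.
  by rewrite /M0; have := mean_norm_le (2 ^ J) L2f0; rewrite -/F; lra.
have := lt_le_trans rho_lt (besov_norm2_le J s0 Bf).
rewrite lte_fin; set B := energy f f0 (2 ^ J) + _ => h.
have B0 : 0 < B.
  by rewrite -sqrtr_gt0; apply: le_lt_trans h; rewrite mulr_ge0 ?sqrtr_ge0 ?ltW.
have : (Num.sqrt (K ^+ 2 + b) * rate) ^+ 2 < B.
  rewrite -(sqr_sqrtr (ltW B0)) ltr_sqr ?nnegrE ?sqrtr_ge0//.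
  by rewrite mulr_ge0 ?sqrtr_ge0 ?ltW.
rewrite exprMn sqr_sqrtr ?(ltW Kb)// mulrDl /B.
have : r ^+ 2 * 2 `^ (- (2 * J%:R * s)) / (1 - 2 `^ (- (2 * s))) <= b * rate ^+ 2.
  rewrite mulrAC -/b; exact: (ler_wpM2l (ltW bpos) Hbias).
by rewrite -/K; lra.
Qed.
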